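(* Let $Q$ be a parabolic subgroup of $G$ and let $L\subset\mathbb C^n$ be a $Q$-invariant complex subspace. If the $Q$-action on $L$ is irreducible, then there exists a $Q$-invariant subspace $W$ of $\mathbb R^n$ such that the $Q$-action on $W$ is irreducible and $L=W^{\mathbb C}$, where $W^{\mathbb C}=W\oplus iW\subset\mathbb C^n$.
   Context: Let $G\subset \mathrm{SL}(n,\mathbb R)$ be a closed connected noncompact semisimple Lie subgroup with Lie algebra $\mathfrak g$ such that $G=K\exp(\mathfrak p)$, where $K=G\cap \mathrm{SO}(n)$, $\mathfrak p=\mathfrak g\cap \mathrm{Sym}_0(n)$ and $\mathrm{Sym}_0(n)$ is the space of trace-zero real symmetric $n\times n$ matrices. Assume that $G$ acts irreducibly on $\mathbb R^n$ and on $\mathbb C^n$. A parabolic subgroup of $G$ is the normalizer in $G$ of a parabolic subalgebra of $\mathfrak g$ (a subalgebra $\mathfrak q$ such that $\mathfrak q^{\mathbb C}$ is parabolic in $\mathfrak g^{\mathbb C}$); equivalently a group of the form $G^{\beta+}=\{g\in G:\ \lim_{t\to-\infty}\exp(t\beta)g\exp(-t\beta)\text{ exists}\}$ with $\beta\in\mathfrak p$. *)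

(* Defs.v *)
(* MathComp-Analysis, with the complex numbers R[i] of mathcomp-real-closed. *)
From HB Require Import structures.
From mathcomp Require Import all_boot all_order all_algebra complex.
From mathcomp Require Import all_classical all_reals all_analysis.

Set Implicit Arguments.
Unset Strict Implicit.
Unset Printing Implicit Defensive.

Import Order.TTheory GRing.Theory Num.Theory.
Import numFieldNormedType.Exports.

Local Open Scope classical_set_scope.
Local Open Scope ring_scope.

Section LinearActions.
Variables (F : fieldType) (n : nat).
Implicit Types (S : set 'M[F]_n) (U W : {vspace 'cV[F]_n}).

Definition invariant_subspace S W :=
  forall g, S g -> forall v, v \in W -> g *m v \in W.

Definition irreducible_action S W :=
  [/\ W != 0%VS, invariant_subspace S W &
      forall U, (U <= W)%VS -> invariant_subspace S U -> U = 0%VS \/ U = W].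

End LinearActions.

Section LieAlgebras.
Variables (F : fieldType) (n : nat).
Implicit Types (X Y : 'M[F]_n) (a b g q : {vspace 'M[F]_n}).

Definition lie_bracket X Y : 'M[F]_n := X *m Y - Y *m X.

Definition lie_bracketv a b : {vspace 'M[F]_n} :=
  <<[seq lie_bracket X Y | X <- vbasis a, Y <- vbasis b]>>%VS.

Definition lie_subalgebra g a := (a <= g)%VS /\ (lie_bracketv a a <= a)%VS.

Definition lie_ideal g a := (a <= g)%VS /\ (lie_bracketv g a <= a)%VS.

Definition lie_solvable a :=
  exists k : nat, iter k (fun b => lie_bracketv b b) a = 0%VS.

(* The radical vanishes. *)
Definition lie_semisimple g :=
  forall a, lie_ideal g a -> lie_solvable a -> a = 0%VS.

Definition borel_subalgebra g b :=
  [/\ lie_subalgebra g b, lie_solvable b &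
      forall a, lie_subalgebra g a -> lie_solvable a -> (b <= a)%VS -> a = b].

(* The usual notion when F is algebraically closed; over the reals see
   real_parabolic_subalgebra. *)
Definition parabolic_subalgebra g q :=
  lie_subalgebra g q /\ exists2 b, borel_subalgebra g b & (b <= q)%VS.

End LieAlgebras.

Section Complexification.
Variable R : realType.

Definition complexify_mx m p (A : 'M[R]_(m, p)) : 'M[R[i]]_(m, p) :=
  map_mx (real_complex R) A.

(* The complex span of W inside the complex matrices, i.e. W (+) iW
   (mem_complexify). *)
Definition complexify m p (W : {vspace 'M[R]_(m, p)}) :
    {vspace 'M[R[i]]_(m, p)} :=
  <<[seq complexify_mx A | A <- vbasis W]>>%VS.

Lemma mem_complexify m p (W : {vspace 'M[R]_(m, p)}) (v : 'M[R[i]]_(m, p)) :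
  v \in complexify W <->
  exists x y, [/\ x \in W, y \in W &
    v = complexify_mx x + (Complex 0 1) *: complexify_mx y].
Proof.
have cD (A B : 'M[R]_(m, p)) :
    complexify_mx (A + B) = complexify_mx A + complexify_mx B.
  exact: map_mxD.
have cZ (c : R) (A : 'M[R]_(m, p)) :
    complexify_mx (c *: A) = (real_complex R c) *: complexify_mx A.
  exact: map_mxZ.
have real_in x : x \in W -> complexify_mx x \in complexify W.
  move=> xW; rewrite (coord_vbasis xW).
  rewrite /complexify_mx map_mx_sum; apply: memv_suml => i _.
  rewrite map_mxZ; apply/memvZ/memv_span/map_f/mem_nth.
  by rewrite size_tuple.
split; last first.
  by move=> [x [y [xW yW ->]]]; rewrite memvD ?memvZ ?real_in.
move=> vW.
have sz : size [seq complexify_mx A | A <- vbasis W] == \dim W.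
  by rewrite size_map size_tuple.
have -> : v = \sum_(i < \dim W)
    coord (Tuple sz) i v *: complexify_mx (vbasis W)`_i.
  rewrite [LHS](coord_span (X := Tuple sz)) //; apply: eq_bigr => i _.
  by rewrite (nth_map 0) ?size_tuple.
exists (\sum_(i < \dim W) complex.Re (coord (Tuple sz) i v) *: (vbasis W)`_i).
exists (\sum_(i < \dim W) complex.Im (coord (Tuple sz) i v) *: (vbasis W)`_i).
have bW i : (i < \dim W)%N -> (vbasis W)`_i \in W.
  by move=> ?; apply/vbasis_mem/mem_nth; rewrite size_tuple.
split; [by apply: memv_suml => i _; rewrite memvZ ?bW | by apply: memv_suml => i _; rewrite memvZ ?bW |].
rewrite /complexify_mx !map_mx_sum scaler_sumr -big_split /=.
apply: eq_bigr => i _; rewrite !map_mxZ scalerA -scalerDl; congr (_ *: _).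
exact: complexE.
Qed.

(* The complex-linear action of real matrices on C^n. *)
Definition complexify_set n (S : set 'M[R]_n) : set 'M[R[i]]_n :=
  [set complexify_mx g | g in S].

End Complexification.

Section MatrixGroups.
Variables (R : realType) (n : nat).
Implicit Types (X A : 'M[R]_n) (G Q : set 'M[R]_n) (g q : {vspace 'M[R]_n}).

Definition expmx A : 'M[R]_n :=
  \matrix_(i, j)
    (lim ([series (k`!%:R)^-1 * (A ^+ k) i j]_k @ \oo) : R).

(* Closedness in SL(n, R) and in the space of all matrices agree, SL(n, R)
   being closed. *)
Definition closed_subgroup_SL G :=
  [/\ forall A, G A -> \det A = 1,
      G 1%:M,
      forall A B, G A -> G B -> G (A *m B),
      forall A, G A -> G (invmx A) &
      closed G].

(* The Lie algebra of a closed subgroup G; it is a linear subspace, so that a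
   (necessarily unique) such g exists. *)
Definition is_lie_algebra_of G g :=
  forall X, X \in g <-> forall t : R, G (expmx (t *: X)).

Definition SO : set 'M[R]_n := [set A | A^T *m A = 1%:M /\ \det A = 1].

Definition Sym0 : set 'M[R]_n := [set X | X^T = X /\ \tr X = 0].

(* G = K exp(p), with K the intersection of G and SO(n), and p that of g
   and Sym_0(n). *)
Definition compatible_decomposition G g :=
  G = [set A | exists k X,
         [/\ (G `&` SO) k, ([set` g] `&` Sym0) X & A = k *m expmx X]].

Definition real_parabolic_subalgebra g q :=
  lie_subalgebra g q /\ parabolic_subalgebra (complexify g) (complexify q).

Definition normalizer_in G q : set 'M[R]_n :=
  [set A | G A /\ forall X, (A *m X *m invmx A \in q) = (X \in q)].

Definition parabolic_subgroup G g Q :=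
  exists2 q, real_parabolic_subalgebra g q & Q = normalizer_in G q.

End MatrixGroups.

(* Main.v *)
Require Import Defs.
From HB Require Import structures.
From mathcomp Require Import all_boot all_order all_algebra complex.
From mathcomp Require Import ring lra.
From mathcomp Require Import all_classical all_reals all_analysis.

Set Implicit Arguments.
Unset Strict Implicit.
Unset Printing Implicit Defensive.

Import Order.TTheory GRing.Theory Num.Theory.
Import numFieldNormedType.Exports.

Local Open Scope classical_set_scope.
Local Open Scope ring_scope.

(** Since [Q] consists of real matrices, the complex conjugate of [L] is again
    [Q]-invariant, and so is its intersection with [L].  As [L] is irreducible,
    it is stable under conjugation, hence the complexification of its real
    points, as soon as it meets its conjugate nontrivially.

    Let [q] be the parabolic subalgebra normalized by [Q] and [b] a Borel
    subalgebra of the complexification [gC] of [g] contained in that of [q].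
    Differentiating the one-parameter groups of [Q] shows that [b] preserves
    [L] and its conjugate; by Lie's theorem each of the two contains an
    eigenvector of [b].  In the irreducible representation of [gC] on C^n all
    eigenvectors of [b] lie on a single line ([borel_eigenvector_unique]), so
    these two are proportional and the two subspaces do meet.

    Uniqueness of the line is proved without root systems.  The decomposition
    G = K exp(p) makes [gC] stable under conjugate transposition.  By Cartan's
    criterion, an element of [gC] outside [b] and orthogonal to [b] for the
    trace form, suitably chosen, could be adjoined to [b] to give a larger
    solvable subalgebra; so the orthogonal of [b] lies in [b]
    ([trace_orthogonal_borel]), and this gives gC = b + b^*
    ([borel_decomposition]).  If [v] and [w] are orthogonal eigenvectors of
    [b], the subspace that b^* generates from [v] is stable under b + b^* and
    orthogonal to [w], against irreducibility.  Hence no two eigenvectors are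
    orthogonal; this forces their weights to agree on the
    intersection of b and b^*, then on [b], because a weight is represented for
    the trace form by a Hermitian element of that intersection.  With equal
    weights the part of [w] orthogonal to [v] is an eigenvector unless it is
    zero, so [w] is a multiple of [v].

    The irreducibility of [gC] comes from that of the group: a subspace stable
    under [g] is stable under the connected group [G]
    ([connected_group_stable]), because its stabilizer contains a neighbourhood
    of 1 in [G] ([subgroup_near_identity]).  This is a case of Cartan's closed
    subgroup theorem: if elements of [G] outside the stabilizer H accumulate
    at 1, replace each of them by a nearly closest point to 1 in its coset
    modulo H; a cluster point Z of the normalized displacements from 1 belongs
    to [g], and multiplying by exp(-eZ) in H gets much closer to 1, a
    contradiction. *)

(** * Linear algebra modulo an invariant subspace *)

Lemma eq_on_scalars (F : fieldType) (V : vectType F) (u v : V) :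
  (forall phi : {scalar V}, phi u = phi v) -> u = v.
Proof.
move=> H; rewrite (coord_vbasis (memvf u)) (coord_vbasis (memvf v)).
by apply: eq_bigr => i _; rewrite (H (coord (vbasis fullv) i)).
Qed.

(** An identity in an abstract vector space is a ring identity once a linear
    form is applied to it. *)
Ltac vector_ring :=
  let phi := fresh "phi" in
  apply: eq_on_scalars => phi;
  rewrite !(linearD phi, linearN phi, scalarZ phi) /=; ring.

Lemma eq_memv (F : fieldType) (V : vectType F) (U : {vspace V}) u v :
  u \in U -> u = v -> v \in U.
Proof. by move=> uU <-. Qed.

Section IteratesModuloSubspace.
Variables (F : fieldType) (V : vectType F) (z : {linear V -> V}).
Implicit Types (U : {vspace V}) (w : V) (p : {poly F}).

Definition iterate_space U w k : {vspace V} :=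
  (U + <<mkseq (fun i => iter i z w) k>>)%VS.

Lemma iterate_space0 U w : iterate_space U w 0 = U.
Proof. by rewrite /iterate_space span_nil addv0. Qed.

Lemma iterate_spaceS U w k :
  iterate_space U w k.+1 = (iterate_space U w k + <[iter k z w]>)%VS.
Proof.
by rewrite /iterate_space /mkseq -addn1 iotaD map_cat span_cat /= span_seq1
  addvA.
Qed.

Lemma sub_iterate_space U w j k :
  (j <= k)%N -> (iterate_space U w j <= iterate_space U w k)%VS.
Proof.
move=> /subnK <-; elim: (k - j)%N => // m IH.
by rewrite addSn iterate_spaceS (subv_trans IH) ?addvSl.
Qed.

Lemma iter_in_iterate_space U w j k :
  (j < k)%N -> iter j z w \in iterate_space U w k.
Proof.
move=> jk; apply: (subvP (sub_iterate_space _ _ jk)).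
by rewrite iterate_spaceS (subvP (addvSr _ _)) ?memv_line.
Qed.

Lemma iterate_space_image U w k v : (forall u, u \in U -> z u \in U) ->
  v \in iterate_space U w k -> z v \in iterate_space U w k.+1.
Proof.
move=> Uz; elim: k v => [|k IH] v.
  rewrite iterate_space0 => /Uz zvU.
  by rewrite iterate_spaceS iterate_space0 (subvP (addvSl _ _)).
rewrite iterate_spaceS => /memv_addP[a aY [b /vlineP[c ->] ->]].
rewrite linearD linearZ /= memvD ?memvZ //; last first.
  exact: (@iter_in_iterate_space U w k.+1).
by rewrite (subvP (sub_iterate_space U w (leqnSn k.+1))) ?IH.
Qed.

(** Dimensions cannot increase forever, so some iterate of [w] depends on the
    previous ones modulo [U]; [k.+1] is the least such exponent, and it is
    positive because [w] is not in [U]. *)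
Lemma first_dependent_iterate U w : w \notin U ->
  exists k, [/\ iter k.+1 z w \in iterate_space U w k.+1,
    iter k z w \notin iterate_space U w k &
    forall j, (j <= k)%N -> iter j z w \notin iterate_space U w j].
Proof.
move=> wU.
have exk : exists k, iter k z w \in iterate_space U w k.
  apply/not_existsP => H.
  have dk k : (k <= \dim (iterate_space U w k))%N.
    elim: k => // k IH; apply: leq_ltn_trans IH _.
    rewrite ltnNge; apply/negP => le; apply: (H k).
    have e : iterate_space U w k == iterate_space U w k.+1.
      by rewrite eqEdim sub_iterate_space.
    by rewrite (eqP e) iter_in_iterate_space.
  have := leq_trans (dk (\dim (fullv : {vspace V})).+1) (dimvS (subvf _)).
  by rewrite ltnn.
have [[|k] Pk mink] := ex_minnP exk; first by rewrite iterate_space0 (negbTE wU) in Pk.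
have lek j : (j <= k)%N -> iter j z w \notin iterate_space U w j.
  by move=> jk; apply: contraL jk => /mink; rewrite ltnNge.
by exists k; split=> //; exact: lek.
Qed.

Definition poly_action p w : V := \sum_(i < size p) p`_i *: iter i z w.

Lemma poly_action_widen p w m : (size p <= m)%N ->
  poly_action p w = \sum_(i < m) p`_i *: iter i z w.
Proof.
move=> le; rewrite /poly_action (big_ord_widen _ (fun i => p`_i *: iter i z w) le).
rewrite big_mkcond; apply: eq_bigr => i _; case: ltnP => // le'.
by rewrite nth_default // scale0r.
Qed.

Lemma poly_action_mulXsub p a w :
  poly_action (('X - a%:P) * p) w = z (poly_action p w) - a *: poly_action p w.
Proof.
have le : (size (('X - a%:P) * p)%R <= (size p).+1)%N.
  by rewrite (leq_trans (size_polyMleq _ _)) // size_XsubC.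
rewrite (poly_action_widen _ le) mulrC.
rewrite [X in _ - a *: X](poly_action_widen _ (leqnSn _)).
rewrite (eq_bigr (fun i : 'I__ => (p * 'X)`_i *: iter i z w
    - a *: (p`_i *: iter i z w))); last first.
  move=> i _; rewrite mulrBr coefB mulrC scalerBl; congr (_ - _).
  by rewrite coefMC scalerA mulrC.
rewrite sumrB -scaler_sumr; congr (_ - _).
rewrite big_ord_recl coefMX eqxx scale0r add0r /poly_action linear_sum.
by apply: eq_bigr => i _; rewrite linearZ /= coefMX.
Qed.

Lemma poly_action_ind (P : V -> Prop) p w :
  P 0 -> (forall c u v, P u -> P v -> P (c *: u + v)) ->
  (forall u, P u -> P (z u)) -> P w -> P (poly_action p w).
Proof.
move=> P0 Plin Pz Pw; rewrite /poly_action.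
apply: (big_ind P) => // [u v Pu Pv|i _]; first by rewrite -(scale1r u); apply: Plin.
rewrite -[_ *: _]addr0; apply: Plin => //.
by elim: (nat_of_ord i) => //= k; apply: Pz.
Qed.

Lemma poly_action_is_linear p k u v :
  poly_action p (k *: u + v) = k *: poly_action p u + poly_action p v.
Proof.
rewrite /poly_action scaler_sumr -big_split; apply: eq_bigr => i _ /=.
have -> : iter i z (k *: u + v) = k *: iter i z u + iter i z v.
  by elim: (nat_of_ord i) => //= m ->; rewrite linearP.
by rewrite scalerDr !scalerA mulrC.
Qed.

Lemma poly_actionD p q u :
  poly_action (p + q) u = poly_action p u + poly_action q u.
Proof.
pose m := maxn (size p) (size q).
rewrite (@poly_action_widen (p + q) u m) ?size_polyD //.
rewrite (@poly_action_widen p u m) ?leq_maxl //.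
rewrite (@poly_action_widen q u m) ?leq_maxr //.
by rewrite -big_split; apply: eq_bigr => i _; rewrite coefD scalerDl.
Qed.

Lemma poly_actionC c u :
  poly_action c%:P u = c *: u.
Proof.
rewrite (@poly_action_widen c%:P u 1) ?size_polyC ?leq_b1 //.
by rewrite big_ord1 coefC eqxx.
Qed.

(** The polynomials in [z] divisible by (X - a)^N kill the generalized
    eigenvectors of eigenvalue [a] and height [N]. *)
Lemma poly_action_mulXsub_exp a p N u :
  iter N (fun v => z v - a *: v) u = 0 ->
  poly_action (('X - a%:P) ^+ N * p) u = 0.
Proof.
have com : forall q v, poly_action q (z v) = z (poly_action q v).
  move=> q v; rewrite /poly_action linear_sum; apply: eq_bigr => i _ /=.
  by rewrite linearZ /= -iterSr.
have lin0 q : poly_action q 0 = 0.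
  have := poly_action_is_linear q (-1) 0 0.
  by rewrite scaler0 addr0 scaleN1r addNr.
elim: N u => [|N IH] u; first by move=> /= ->; rewrite lin0.
rewrite iterSr => /IH e.
rewrite exprS -mulrA poly_action_mulXsub -{}[RHS]e.
have -> : z u - a *: u = (- a) *: u + z u by rewrite scaleNr addrC.
by rewrite poly_action_is_linear com addrC scaleNr.
Qed.

End IteratesModuloSubspace.

Section EigenvectorModuloSubspace.
Variables (F : closedFieldType) (V : vectType F) (z : {linear V -> V}).

(** A monic polynomial p with p(z) w in [U] splits into linear factors; the
    last partial product that does not yet send [w] into [U] yields an
    eigenvector modulo [U].  The predicate [P] stands for any condition stable
    under linear combinations and [z], not only membership in a subspace. *)
Lemma eigenvector_modulo (P : V -> Prop) (U : {vspace V}) w :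
  P 0 -> (forall c u v, P u -> P v -> P (c *: u + v)) ->
  (forall u, P u -> P (z u)) -> P w -> w \notin U ->
  exists w', [/\ P w', w' \notin U & exists l, z w' - l *: w' \in U].
Proof.
move=> P0 Plin Pz Pw wU.
have [k [+ _ _]] := first_dependent_iterate z wU.
rewrite /iterate_space => /memv_addP[u uU [y yY e]].
have sz : size (mkseq (fun i => iter i z w) k.+1) == k.+1 by rewrite size_mkseq.
pose q := \poly_(i < k.+1) coord (Tuple sz) (inord i) y.
have eqp : y = \sum_(i < k.+1) q`_i *: iter i z w.
  rewrite [LHS](coord_span (X := Tuple sz)) //; apply: eq_bigr => i _.
  by rewrite coef_poly ltn_ord inord_val nth_mkseq.
pose p := 'X^(k.+1) - q.
have szq : (size (- q) < size ('X^(k.+1) : {poly F}))%N.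
  by rewrite size_polyN size_polyXn ltnS size_poly.
have szp : size p = k.+2 by rewrite size_polyDl // size_polyXn.
have pU : poly_action z p w \in U.
  rewrite (@poly_action_widen _ _ _ _ _ k.+2) ?szp //.
  rewrite (eq_bigr (fun i : 'I__ => ('X^(k.+1))`_i *: iter i z w - q`_i *: iter i z w));
    last by move=> i _; rewrite coefB scalerBl.
  rewrite sumrB big_ord_recr /= coefXn eqxx scale1r.
  rewrite [X in X + _ - _]big1 ?add0r; last first.
    by move=> i _; rewrite coefXn ltn_eqF ?ltn_ord // scale0r.
  rewrite big_ord_recr /= -eqp [q`_k.+1]nth_default ?size_poly // scale0r addr0.
  by rewrite -iterS e addrK.
have [rs prs] := closed_field_poly_normal p.
have lp : lead_coef p = 1.
  by rewrite lead_coefDl // lead_coefXn.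
rewrite lp scale1r in prs; rewrite {}prs in pU.
elim: rs pU => [|r rs IH].
  by rewrite big_nil /poly_action size_poly1 big_ord1 coefC eqxx scale1r /= (negbTE wU).
rewrite big_cons poly_action_mulXsub.
set u' := poly_action _ _ _ => zU.
case: (boolP (u' \in U)) => [/IH //|u'U].
exists u'; split=> //; last by exists r.
exact: poly_action_ind.
Qed.

End EigenvectorModuloSubspace.

(** * Lie brackets, and Lie's theorem modulo an invariant subspace *)
Section LieBrackets.
Variables (F : fieldType) (n : nat).
Implicit Types (X Y Z : 'M[F]_n) (a b c : {vspace 'M[F]_n}).

Lemma lie_bracket_linear_r X : linear (lie_bracket X).
Proof.
move=> k A B; rewrite /lie_bracket mulmxDr mulmxDl -scalemxAr -scalemxAl.
by rewrite scalerBr opprD addrACA.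
Qed.

HB.instance Definition _ X :=
  GRing.isLinear.Build F 'M[F]_n 'M[F]_n _ (lie_bracket X) (lie_bracket_linear_r X).

Lemma lie_bracketC X Y : lie_bracket X Y = - lie_bracket Y X.
Proof. by rewrite /lie_bracket opprB. Qed.

Lemma lie_bracketDZl Y k A B :
  lie_bracket (k *: A + B) Y = k *: lie_bracket A Y + lie_bracket B Y.
Proof. by rewrite lie_bracketC linearP opprD -scalerN -!(lie_bracketC _ Y). Qed.

Lemma lie_bracketDl A B Y :
  lie_bracket (A + B) Y = lie_bracket A Y + lie_bracket B Y.
Proof. by rewrite -[A]scale1r lie_bracketDZl !scale1r. Qed.

Lemma lie_bracketZl k A Y : lie_bracket (k *: A) Y = k *: lie_bracket A Y.
Proof. by rewrite lie_bracketC linearZ -scalerN -lie_bracketC. Qed.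

Lemma lie_bracket_self X : lie_bracket X X = 0.
Proof. by rewrite /lie_bracket subrr. Qed.

Lemma lie_bracket_jacobi X Y Z :
  lie_bracket (lie_bracket X Y) Z =
  lie_bracket X (lie_bracket Y Z) - lie_bracket Y (lie_bracket X Z).
Proof.
rewrite /lie_bracket !(mulmxBl, mulmxBr) !mulmxA !opprB.
set a := X *m Y *m Z; set a' := Y *m X *m Z.
set d := Z *m X *m Y; set d' := Z *m Y *m X.
set e := X *m Z *m Y; set f := Y *m Z *m X.
apply/matrixP=> i j; rewrite !mxE; ring.
Qed.

Lemma memv_lie_bracket a b X Y :
  X \in a -> Y \in b -> lie_bracket X Y \in lie_bracketv a b.
Proof.
move=> Xa Yb; rewrite (coord_vbasis Yb) linear_sum; apply: memv_suml => i _.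
rewrite linearZ memvZ //= lie_bracketC memvN (coord_vbasis Xa) linear_sum.
apply: memv_suml => j _; rewrite linearZ memvZ //= -memvN -lie_bracketC.
apply: memv_span; apply/allpairsP; exists ((vbasis a)`_j, (vbasis b)`_i) => /=.
by split=> //; apply: mem_nth; rewrite size_tuple.
Qed.

Lemma lie_bracketv_subP a b c :
  (lie_bracketv a b <= c)%VS <->
  forall X Y, X \in a -> Y \in b -> lie_bracket X Y \in c.
Proof.
split=> [/subvP le X Y Xa Yb|H]; first exact/le/memv_lie_bracket.
apply/span_subvP => _ /allpairsP[[X Y] /= [Xa Yb ->]].
by apply: H; apply: vbasis_mem.
Qed.

Lemma lie_bracketvS a a' b b' : (a <= a')%VS -> (b <= b')%VS ->
  (lie_bracketv a b <= lie_bracketv a' b')%VS.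
Proof.
move=> /subvP aa /subvP bb; apply/lie_bracketv_subP => X Y /aa Xa /bb Yb.
exact: memv_lie_bracket.
Qed.

(** The step of the derived series iterated in [lie_solvable]. *)
Definition derived_algebra a := lie_bracketv a a.

Lemma iter_derived_algebraS a b k : (a <= b)%VS ->
  (iter k derived_algebra a <= iter k derived_algebra b)%VS.
Proof. by move=> ab; elim: k => //= k IH; apply: lie_bracketvS. Qed.

Lemma lie_solvableS a b : (a <= b)%VS -> lie_solvable b -> lie_solvable a.
Proof.
move=> ab [k bk]; exists k; apply/eqP; rewrite -subv0 -bk.
exact: iter_derived_algebraS.
Qed.

Lemma lie_solvable_iter a k :
  lie_solvable (iter k derived_algebra a) -> lie_solvable a.
Proof.
by move=> [m e]; exists (m + k)%N; rewrite iterD.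
Qed.

End LieBrackets.

Section LieTheorem.
Variables (C : numClosedFieldType) (n : nat) (V : vectType C).
Variable rho : 'M[C]_n -> {linear V -> V}.
Hypothesis rho_linear : forall v k X Y,
  rho (k *: X + Y) v = k *: rho X v + rho Y v.
Hypothesis rho_bracket : forall X Y v,
  rho (lie_bracket X Y) v = rho X (rho Y v) - rho Y (rho X v).
Implicit Types (h s : {vspace 'M[C]_n}) (U W : {vspace V}).

(** On the flag generated by the iterates y_k of [w] under rho Z, an element X
    of [h] acts triangularly: X y_k = l(X) y_k + k l([X, Z]) y_(k-1) modulo
    lower terms.  Applying this to the first dependent iterate gives
    k l([X, Z]) y_(k-1) in the span of the terms below y_(k-1), with k nonzero,
    so l([X, Z]) vanishes in characteristic 0. *)
Lemma weight_bracket_eq0 h Z U w (l : 'M[C]_n -> C) :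
  (forall X, X \in h -> lie_bracket X Z \in h) ->
  (forall X u, X \in h -> u \in U -> rho X u \in U) ->
  (forall u, u \in U -> rho Z u \in U) ->
  w \notin U ->
  (forall X, X \in h -> rho X w - l X *: w \in U) ->
  forall X, X \in h -> l (lie_bracket X Z) = 0.
Proof.
move=> hZ Uh UZ wU lw.
pose y k := iter k (rho Z) w.
pose Y := iterate_space (rho Z) U w.
have UY k u : u \in U -> u \in Y k.
  by move=> uU; apply: (subvP (sub_iterate_space _ _ _ (leq0n k))); rewrite iterate_space0.
have claim k X : X \in h ->
    rho X (y k) - l X *: y k - (k%:R * l (lie_bracket X Z)) *: y k.-1 \in Y k.-1.
  elim: k X => [|k IH] X Xh.
    by rewrite mul0r scale0r subr0 /Y iterate_space0 lw.
  have cY X' : X' \in h -> (k%:R * l (lie_bracket X' Z)) *: y k.-1 \in Y k.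
    case: k {IH} => [|k] X'h; first by rewrite mul0r scale0r mem0v.
    by rewrite memvZ // iter_in_iterate_space.
  have Yk : (Y k.-1 <= Y k)%VS by rewrite sub_iterate_space ?leq_pred.
  have Zc X' : rho Z ((k%:R * l (lie_bracket X' Z)) *: y k.-1) =
       (k%:R * l (lie_bracket X' Z)) *: y k.
    case: k {IH cY Yk} => [|k]; first by rewrite mul0r !scale0r linear0.
    by rewrite linearZ.
  have ZY e : e \in Y k.-1 -> rho Z e \in Y k.
    case: (k) => [|m]; last exact: iterate_space_image.
    by rewrite /Y iterate_space0 => /UZ.
  have e1 := ZY _ (IH X Xh); have e2 := IH _ (hZ X Xh).
  rewrite !linearB /= Zc linearZ /= in e1.
  have e3 : rho (lie_bracket X Z) (y k) - l (lie_bracket X Z) *: y k \in Y k.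
    rewrite -[_ - _](subrK ((k%:R * l (lie_bracket (lie_bracket X Z) Z)) *: y k.-1)).
    by apply: memvD; [apply: (subvP Yk) | apply/cY/hZ].
  apply: (eq_memv (memvD e1 e3)); rewrite rho_bracket /=.
  by rewrite -[k.+1%:R]natr1; vector_ring.
move=> X Xh.
have [k [yY ynY lek]] := first_dependent_iterate (rho Z) wU.
have phiY v : v \in Y k.+1 -> rho X v - l X *: v \in Y k.
  have phiy j : (j <= k)%N -> rho X (y j) - l X *: y j \in Y k.
    move=> jk; have := claim j X Xh; case: j jk => [|j] jk.
      rewrite mul0r scale0r subr0; apply: subvP; exact: sub_iterate_space.
    move=> cl.
    rewrite -[_ - _](subrK ((j.+1%:R * l (lie_bracket X Z)) *: y j)).
    rewrite memvD ?memvZ ?iter_in_iterate_space //.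
    by apply: subvP cl; apply/sub_iterate_space/ltnW.
  have : (k.+1 <= k.+1)%N by [].
  elim: {-2}k.+1 v => [|m IH] v mk.
    rewrite /Y iterate_space0 => vU; apply: UY.
    by rewrite memvB ?memvZ ?Uh.
  rewrite /Y iterate_spaceS => /memv_addP[a aY [b /vlineP[c ->] ->]].
  apply: (eq_memv (memvD (IH a (ltnW mk) aY) (memvZ c (phiy m mk)))).
  by rewrite [rho X (_ + _)]linearD [rho X (_ *: _)]linearZ /=; vector_ring.
have := phiY _ yY; have := claim k.+1 X Xh; rewrite /= => c1 c2.
have := memvB c2 c1; rewrite opprB addrC subrK => cy.
apply: contraNeq ynY => c0.
have nz : k.+1%:R * l (lie_bracket X Z) != 0 by rewrite mulf_neq0 // pnatr_eq0.
by rewrite -[iter k _ w](scalerK nz) memvZ.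
Qed.

(** By [weight_bracket_eq0] the weight space of [w] for [h] modulo [U] is stable
    under [Z], which has an eigenvector in it. *)
Lemma common_eigenvector_adjoin h Z U W w :
  (forall X, X \in h -> lie_bracket X Z \in h) ->
  (forall X u, X \in h -> u \in U -> rho X u \in U) ->
  (forall u, u \in U -> rho Z u \in U) ->
  (forall u, u \in W -> rho Z u \in W) ->
  w \in W -> w \notin U ->
  (forall X, X \in h -> exists l, rho X w - l *: w \in U) ->
  exists w', [/\ w' \in W, w' \notin U &
    forall X, X \in (h + <[Z]>)%VS -> exists l, rho X w' - l *: w' \in U].
Proof.
move=> hZ Uh UZ WZ wW wU lw.
have /choice[l lP] X : exists l, X \in h -> rho X w - l *: w \in U.
  by case: (boolP (X \in h)) => [/lw[c]|_]; [exists c | exists 0].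
have l0 := weight_bracket_eq0 hZ Uh UZ wU lP.
pose P v := v \in W /\ forall X, X \in h -> rho X v - l X *: v \in U.
have [||||w' [[w'W w'l] w'U [m Zw']]] :=
    @eigenvector_modulo _ _ (rho Z) P U w _ _ _ _ wU.
- by split=> [|X _]; rewrite ?mem0v // linear0 scaler0 subr0 mem0v.
- move=> c u v [uW ul] [vW vl]; split=> [|X Xh]; first by rewrite memvD ?memvZ.
  apply: (eq_memv (memvD (memvZ c (ul X Xh)) (vl X Xh))).
  by rewrite [rho X (_ + _)]linearD [rho X (_ *: _)]linearZ /=; vector_ring.
- move=> u [uW ul]; split=> [|X Xh]; first exact: WZ.
  apply: (eq_memv (memvD (UZ _ (ul X Xh)) (ul _ (hZ X Xh)))).
  rewrite l0 // scale0r subr0 rho_bracket.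
  by rewrite [rho Z (_ - _)]linearB [rho Z (_ *: _)]linearZ /=; vector_ring.
- by [].
exists w'; split=> // X /memv_addP[a ah [b /vlineP[c ->] ->]].
exists (l a + c * m).
apply: (eq_memv (memvD (w'l a ah) (memvZ c Zw'))).
by rewrite (addrC a) rho_linear; vector_ring.
Qed.

(** Lie's theorem for the quotient of [W] by [U], stated without forming the
    quotient.  Starting from the derived algebra, which is treated by induction
    on the derived length, the elements of a basis of [s] are adjoined one at a
    time; every intermediate space contains all brackets of [s]. *)
Theorem lie_theorem_modulo s U W w :
  lie_solvable s -> (lie_bracketv s s <= s)%VS ->
  (forall X u, X \in s -> u \in U -> rho X u \in U) ->
  (forall X u, X \in s -> u \in W -> rho X u \in W) ->
  w \in W -> w \notin U ->
  exists w', [/\ w' \in W, w' \notin U &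
    forall X, X \in s -> exists l, rho X w' - l *: w' \in U].
Proof.
case=> k; elim: k s => [|k IH] s.
  move=> /= -> _ _ _ wW wU; exists w; split=> // X; rewrite memv0 => /eqP->.
  exists 0; have := rho_linear w 1 0 0.
  rewrite scaler0 addr0 scale1r => /(congr1 (+%R^~ (- rho 0 w))).
  by rewrite addrK subrr => <-; rewrite scale0r subr0 mem0v.
rewrite iterSr => sol sub Us Ws wW wU.
have /subvP Ds := sub.
have [|||w0 [w0W w0U w0l]] := IH _ sol _ _ _ wW wU.
- by apply: lie_bracketvS.
- by move=> X u /Ds; apply: Us.
- by move=> X u /Ds; apply: Ws.
have : forall zs : seq 'M[C]_n, {subset zs <= s} ->
    exists w', [/\ w' \in W, w' \notin U &
      forall X, X \in (<<zs>> + lie_bracketv s s)%VS ->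
        exists l, rho X w' - l *: w' \in U].
  elim=> [_|z zs IHz zss].
    by exists w0; split=> // X; rewrite span_nil add0v; apply: w0l.
  have [|w1 [w1W w1U w1l]] := IHz.
    by move=> x xz; apply: zss; rewrite inE xz orbT.
  have zs' : z \in s by apply: zss; rewrite mem_head.
  have hs : (<<zs>> + lie_bracketv s s <= s)%VS.
    rewrite subv_add sub andbT; apply/span_subvP => x xz.
    by apply: zss; rewrite inE xz orbT.
  have := common_eigenvector_adjoin (h := (<<zs>> + lie_bracketv s s)%VS)
    (Z := z) _ _ _ _ w1W w1U w1l.
  rewrite span_cons -addvA [(<[z]> + _)%VS]addvC; apply.
  - move=> X Xh; apply: (subvP (addvSr _ _)).
    by apply: memv_lie_bracket zs'; apply: (subvP hs).
  - by move=> X u /(subvP hs); apply: Us.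
  - by move=> u; apply: Us.
  - by move=> u; apply: Ws.
move=> /(_ (vbasis s)) [X|w' [w'W w'U w'l]]; first exact: vbasis_mem.
exists w'; split=> // X Xs; apply: w'l; apply: (subvP (addvSl _ _)).
by rewrite (span_basis (vbasisP s)).
Qed.

End LieTheorem.

(** * Nilpotency and the conjugate of the semisimple part of a matrix *)
Section Triangular.
Variable F : fieldType.

Lemma mulmx_trig n (A B : 'M[F]_n) : is_trig_mx A -> is_trig_mx B ->
  is_trig_mx (A *m B) /\ forall i, (A *m B) i i = A i i * B i i.
Proof.
move=> /is_trig_mxP At /is_trig_mxP Bt; split.
  apply/is_trig_mxP => i j ij; rewrite !mxE big1 // => k _.
  case: (ltnP i k) => ik; first by rewrite At // mul0r.
  by rewrite Bt ?mulr0 // (leq_ltn_trans ik).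
move=> i; rewrite !mxE (bigD1 i) //= big1 ?addr0 // => k ki.
case: (ltngtP i k) => [ik|ik|/val_inj ik]; first by rewrite At // mul0r.
  by rewrite Bt ?mulr0.
by rewrite ik eqxx in ki.
Qed.

Lemma horner_mx_trig n (A : 'M[F]_n.+1) p : is_trig_mx A ->
  is_trig_mx (horner_mx A p) /\ forall i, horner_mx A p i i = p.[A i i].
Proof.
move=> At; elim/poly_ind: p => [|p c [pt pd]].
  by rewrite rmorph0; split=> [|i]; rewrite ?mx0_is_trig // mxE horner0.
have [mt md] := mulmx_trig pt At.
rewrite rmorphD rmorphM /= horner_mx_X horner_mx_C; split.
  move/is_trig_mxP: mt => mt.
  apply/is_trig_mxP => i j ij; rewrite mxE -[_ * A]/(_ *m A) mt // add0r mxE.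
  by rewrite -val_eqE ltn_eqF.
by move=> i; rewrite mxE -[_ * A]/(_ *m A) md pd mxE eqxx !hornerE.
Qed.

End Triangular.

Section Nilpotent.
Variable C : numClosedFieldType.

Lemma Schur_unit n (A : 'M[C]_n) : exists P T,
  [/\ P \in unitmx, is_trig_mx T & A = invmx P *m T *m P].
Proof.
case: n A => [|n] A.
  by exists 1%:M, 0; rewrite unitmx1 mx0_is_trig; split=> //; apply/matrixP => -[].
have [P Pu] := Schur A (ltn0Sn n).
have Pun := unitarymx_unit Pu.
rewrite /similar_to conjumx //= => Pt.
by exists P, (P *m A *m invmx P); split=> //; rewrite !mulmxA mulVmx // mul1mx mulmxKV.
Qed.

Lemma nilpotent_of_diag0 n (P T : 'M[C]_n) : P \in unitmx -> is_trig_mx T ->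
  (forall i, T i i = 0) -> (invmx P *m T *m P) ^+ n = 0.
Proof.
case: n P T => [|n] P T Pu Tt T0; first by apply/matrixP => -[].
have cT : char_poly T = 'X^(n.+1).
  rewrite char_poly_trig // (eq_bigr (fun=> 'X)) => [|i _]; last first.
    by rewrite T0 subr0.
  by rewrite prodr_const card_ord.
have := Cayley_Hamilton T; rewrite cT rmorphXn /= horner_mx_X => Tn.
have Pu' : P \is a GRing.unit by [].
have powc k : (invmx P *m T *m P) ^+ k = invmx P *m T ^+ k *m P.
  elim: k => [|k IH]; first by rewrite !expr0 mulmx1 mulVmx.
  by rewrite !exprS IH -![_ * _]/(_ *m _) !mulmxA mulmxK.
by rewrite powc Tn mulmx0 mul0mx.
Qed.

Lemma mxtrace_nilpotent n (A : 'M[C]_n) k : A ^+ k = 0 -> \tr A = 0.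
Proof.
have [P [T [Pu Tt ->]]] := Schur_unit A.
case: n P T Pu Tt {A} => [|n] P T Pu Tt; first by rewrite /mxtrace big_ord0.
have powc j : (invmx P *m T *m P) ^+ j = invmx P *m T ^+ j *m P.
  elim: j => [|j IH]; first by rewrite !expr0 mulmx1 mulVmx.
  by rewrite !exprS IH -![_ * _]/(_ *m _) !mulmxA mulmxK.
rewrite powc => /(congr1 (fun M => P *m M *m invmx P)).
rewrite !mulmxA mulmxV // mul1mx mulmxK // mulmx0 mul0mx => Tk.
rewrite -mulmxA mxtrace_mulC -mulmxA mulmxV // mulmx1.
rewrite /mxtrace big1 // => i _.
have [_ /(_ i)] := horner_mx_trig 'X^k Tt.
rewrite rmorphXn /= horner_mx_X Tk mxE hornerXn => /esym/eqP.
by rewrite expf_eq0 => /andP[_ /eqP].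
Qed.

End Nilpotent.

Section PolynomialCRT.
Variable F : fieldType.
Implicit Types (s : seq F) (p q : {poly F}).

Lemma coprimep_XsubC_exp (a b : F) N M : a != b ->
  coprimep (('X - a%:P) ^+ N) (('X - b%:P) ^+ M).
Proof.
move=> ab; apply/coprimep_expl/coprimep_expr/coprimep_XsubC2.
by rewrite subr_eq0 eq_sym.
Qed.

Lemma coprimep_prod_XsubC s b (e : F -> nat) M : b \notin s ->
  coprimep (\prod_(a <- s) ('X - a%:P) ^+ e a) (('X - b%:P) ^+ M).
Proof.
elim: s => [|a s IH]; first by rewrite big_nil coprime1p.
rewrite inE negb_or big_cons => /andP[ab bs].
by rewrite coprimepMl IH // andbT coprimep_XsubC_exp // eq_sym.
Qed.

Lemma prod_XsubC_dvdp s (e : F -> nat) p : uniq s ->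
  (forall a, a \in s -> ('X - a%:P) ^+ e a %| p) ->
  \prod_(a <- s) ('X - a%:P) ^+ e a %| p.
Proof.
elim: s => [|a s IH] /=; first by rewrite big_nil dvd1p.
move=> /andP[as_ us] H; rewrite big_cons mulrC Gauss_dvdp ?coprimep_prod_XsubC //.
by rewrite IH ?H ?mem_head // => b bs; apply: H; rewrite inE bs orbT.
Qed.

(** The Chinese remainder theorem for powers of distinct linear polynomials. *)
Lemma poly_interpolation s (f : F -> F) N : uniq s ->
  exists q, forall a, a \in s -> ('X - a%:P) ^+ N %| q - (f a)%:P.
Proof.
elim: s => [|a s IH] /=; first by exists 0.
move=> /andP[as_ /IH[q qP]].
have /Bezout_eq1_coprimepP[[u v] /= uv] := coprimep_prod_XsubC (fun=> N) N as_.
set P := \prod_(_ <- _) _ in uv.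
exists (q + ((f a)%:P - q) * u * P) => b; rewrite inE => /orP[/eqP->|bs].
  rewrite (_ : q + _ - _ = (q - (f a)%:P) * (1 - u * P)); last by ring.
  by rewrite -uv [u * P + _]addrC addrK mulrA dvdp_mull.
rewrite addrAC dvdp_add ?qP // dvdp_mull //.
by rewrite /P (big_rem b) //= dvdp_mulr.
Qed.

Lemma prod_XsubC_seq_dvdp (d : seq F) p :
  (forall a, a \in d -> ('X - a%:P) ^+ size d %| p) ->
  \prod_(a <- d) ('X - a%:P) %| p.
Proof.
move=> H; rewrite -big_undup_iterop_count.
rewrite (eq_bigr (fun a => ('X - a%:P) ^+ count_mem a d)) //.
apply: prod_XsubC_dvdp => [|a]; first exact: undup_uniq.
rewrite mem_undup => /H; apply: dvdp_trans; apply: dvdp_exp2l.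
exact: count_size.
Qed.

End PolynomialCRT.

Section ConjugateEigenvalues.
Variables (C : numClosedFieldType) (n : nat).
Implicit Types (x y w : 'M[C]_n.+1) (A B : {vspace 'M[C]_n.+1}).

(** The matrix y is the complex conjugate of the semisimple part of [x] in the
    Jordan decomposition: it acts by the conjugate of [a] on the generalized
    eigenspace of [x] for [a].  Then tr(x y) is the sum of the squared moduli
    of the eigenvalues of [x], so it vanishes only if [x] is nilpotent.  Both y
    and ad y are obtained by interpolation as polynomials in [x] and in ad x,
    the latter without constant term, which gives the second property. *)
Lemma conjugate_eigenvalue_matrix x : exists y,
  (\tr (x *m y) = 0 -> x ^+ n.+1 = 0) /\
  forall A B, (A <= B)%VS ->
    (forall w, w \in B -> lie_bracket x w \in A) ->
    forall w, w \in B -> lie_bracket y w \in A.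
Proof.
have [P [T [Pu Tt eqx]]] := Schur_unit x.
pose d := [seq T i i | i <- enum 'I_n.+1].
have szd : size d = n.+1 by rewrite size_map size_enum_ord.
pose s := undup d; pose N := n.+1.
have us : uniq s by apply: undup_uniq.
have Ts i : T i i \in s by rewrite mem_undup; apply/mapP; exists i; rewrite ?mem_enum.
have kill p : (forall a, a \in s -> ('X - a%:P) ^+ N %| p) -> horner_mx x p = 0.
  move=> H; have : char_poly T %| p.
    rewrite char_poly_trig // (_ : \prod_(i < n.+1) _ = \prod_(a <- d) ('X - a%:P)).
      apply: prod_XsubC_seq_dvdp => a; rewrite szd -mem_undup; exact: H.
    by rewrite big_map big_enum.
  case/dvdpP => r ->; rewrite eqx horner_mx_uconjC // rmorphM /=.
  by rewrite Cayley_Hamilton mulr0 mulmx0 mul0mx.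
have [q qP] := poly_interpolation (fun a => a^*) N us.
have /choice[E EP] a := poly_interpolation (fun b => (b == a)%:R) N us.
pose ev := horner_mx x; pose e a := ev (E a).
have evM p1 p2 : ev (p1 * p2) = ev p1 *m ev p2 by rewrite /ev rmorphM.
have evX a : ev ('X - a%:P) = x - a%:M.
  by rewrite /ev rmorphB /= horner_mx_X horner_mx_C.
have sumE : \sum_(a <- s) e a = 1%:M.
  apply/eqP; rewrite -subr_eq0 /e /ev -rmorph_sum -[1%:M](rmorph1 (horner_mx x)).
  rewrite -rmorphB /=; apply/eqP/kill => b bs.
  have -> : \sum_(a <- s) E a - 1 = \sum_(a <- s) (E a - ((b == a)%:R)%:P).
    rewrite sumrB; congr (_ - _); rewrite (bigD1_seq b) //= eqxx big1 ?addr0 //.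
    by move=> a; rewrite eq_sym => /negbTE->.
  rewrite big_seq; apply: (big_ind (fun p => _ %| p)) => [|p1 p2|a _].
  - exact: dvdp0.
  - exact: dvdp_add.
  - exact: EP.
have killE a p : a \in s -> ('X - a%:P) ^+ N %| p -> ev (p * E a) = 0.
  move=> as_ pa; apply: kill => b bs; have := EP a b bs.
  case: eqVneq => [->|_]; first by rewrite dvdp_mulr.
  by rewrite subr0 => ?; rewrite dvdp_mull.
pose y := ev q.
pose D : {linear 'M[C]_n.+1 -> 'M[C]_n.+1} := lie_bracket x.
pose S := undup [seq a - b | a <- s, b <- s].
(* The products e_a w e_b are generalized eigenvectors of ad x of eigenvalue
   a - b; N + N is the height that their two factors of height N give. *)
have [r rP] := poly_interpolation (fun a => a^*) (N + N) (undup_uniq _ : uniq S).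
have SS a b : a \in s -> b \in s -> a - b \in S.
  by move=> as_ bs; rewrite mem_undup; apply/allpairsP; exists (a, b).
(* 0 is one of the differences of eigenvalues, so r has no constant term. *)
have [r' rr'] : exists r', r = ('X - 0%:P) * r'.
  have := rP 0; rewrite -[X in X \in S](subrr (T ord0 ord0)) SS // => /(_ isT).
  have -> : r - (0^*)%:P = r by rewrite conjC0 polyC0 subr0.
  move=> /dvdpP[r2 ->]; exists (r2 * ('X - 0%:P) ^+ (N + n)).
  by rewrite /N addnS exprS; ring.
pose piece a b i j w : 'M[C]_n.+1 :=
  ev (('X - a%:P) ^+ i * E a) *m w *m ev (('X - b%:P) ^+ j * E b).
have pieceD a b i j w : D (piece a b i j w) - (a - b) *: piece a b i j w =
    piece a b i.+1 j w - piece a b i j.+1 w.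
  have L : ev (('X - a%:P) ^+ i.+1 * E a) = (x - a%:M) *m ev (('X - a%:P) ^+ i * E a).
    by rewrite exprS -mulrA evM evX.
  have R : ev (('X - b%:P) ^+ j.+1 * E b) = ev (('X - b%:P) ^+ j * E b) *m (x - b%:M).
    by rewrite exprS -mulrA mulrC evM evX.
  rewrite /piece {}L {}R /D /= /lie_bracket.
  move: (ev _) (ev _) => u v.
  rewrite !(mulmxBl, mulmxBr) !mul_scalar_mx !mul_mx_scalar.
  by rewrite -!scalemxAr -!scalemxAl !mulmxA; vector_ring.
have nil k a b i j w : a \in s -> b \in s -> (N + N <= i + j + k)%N ->
    iter k (fun v => D v - (a - b) *: v) (piece a b i j w) = 0.
  move=> as_ bs; elim: k i j => [|k IH] i j.
    rewrite addn0 /= => le; rewrite /piece.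
    case: (leqP N i) => Ni.
      by rewrite killE ?mul0mx ?dvdp_exp2l.
    rewrite (killE b _ bs) ?mulmx0 // dvdp_exp2l //.
    by rewrite leqNgt; apply/negP => jN; move: le; rewrite leqNgt -addnS leq_add // ltnW.
  move=> le; rewrite iterSr pieceD.
  have iterB u v : iter k (fun v => D v - (a - b) *: v) (u - v) =
     iter k (fun v => D v - (a - b) *: v) u - iter k (fun v => D v - (a - b) *: v) v.
    by elim: k {IH le} => //= k ->; rewrite linearB; vector_ring.
  rewrite addnS in le; rewrite iterB !IH ?subr0 //.
  by rewrite addnS addSn.
have ye a : a \in s -> y *m e a = a^* *: e a.
  move=> as_; apply/eqP; rewrite -subr_eq0 -mul_scalar_mx -mulmxBl.
  have -> : y - (a^*)%:M = ev (q - (a^*)%:P) by rewrite /ev rmorphB /= horner_mx_C.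
  by rewrite -evM killE // qP.
have ey a : a \in s -> e a *m y = a^* *: e a.
  by move=> as_; rewrite -ye // -!evM mulrC.
have key w : lie_bracket y w = poly_action D r w.
  have decw : w = \sum_(a <- s) \sum_(b <- s) piece a b 0 0 w.
    rewrite -[LHS]mul1mx -[LHS]mulmx1 -sumE !mulmx_suml; apply: eq_bigr => a _.
    by rewrite mulmx_sumr; apply: eq_bigr => b _; rewrite /piece !expr0 !mul1r.
  have act0 : poly_action D r 0 = 0.
    have := poly_action_is_linear D r (-1) 0 0.
    by rewrite scaler0 addr0 scaleN1r addNr.
  have actD u v : poly_action D r (u + v) = poly_action D r u + poly_action D r v.
    by rewrite -[u]scale1r poly_action_is_linear !scale1r.
  rewrite [in LHS]decw [in RHS]decw linear_sum (big_morph _ actD act0).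
  apply: eq_big_seq => a as_.
  rewrite linear_sum (big_morph _ actD act0).
  apply: eq_big_seq => b bs /=.
  have -> : lie_bracket y (piece a b 0 0 w) = (a - b)^* *: piece a b 0 0 w.
    rewrite /lie_bracket /piece !expr0 !mul1r -[ev (E a)]/(e a) -[ev (E b)]/(e b).
    by rewrite !mulmxA ye // -[_ *m e b *m y]mulmxA ey // -!scalemxAl -scalemxAr
      -scalerBl rmorphB.
  have /dvdpP[r2 r2P] := rP _ (SS _ _ as_ bs).
  rewrite -[r](subrK ((a - b)^*)%:P) r2P poly_actionD poly_actionC mulrC.
  by rewrite poly_action_mulXsub_exp ?add0r // nil // addn0.
exists y; split.
  rewrite /y /ev {2}eqx horner_mx_uconjC // => tr0.
  have : \tr (T *m horner_mx T q) = 0.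
    rewrite -[RHS]tr0 eqx !mulmxA mulmxK // [RHS]mxtrace_mulC !mulmxA mulmxV //.
    by rewrite mul1mx.
  have [qt qd] := horner_mx_trig q Tt; have [_ md] := mulmx_trig Tt qt.
  rewrite /mxtrace (eq_bigr (fun i => T i i * (T i i)^*)); last first.
    move=> i _; rewrite md qd; congr (_ * _).
    have /dvdpP[q2 q2P] := qP _ (Ts i).
    rewrite -[q](subrK ((T i i)^*)%:P) q2P hornerD hornerM horner_exp hornerXsubC.
    by rewrite subrr expr0n mulr0 add0r hornerC.
  move=> /eqP; rewrite psumr_eq0 => [/allP T0|i _]; last exact: mul_conjC_ge0.
  rewrite eqx; apply: nilpotent_of_diag0 => // i.
  have := T0 i (mem_index_enum i); rewrite /= mul_conjC_eq0.
  by move/eqP.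
move=> A B /subvP AB xBA w wB; rewrite key rr' poly_action_mulXsub scale0r subr0.
have xBB u : u \in B -> lie_bracket x u \in B by move/xBA/AB.
apply: (xBA); apply: (@poly_action_ind _ _ D (fun v => v \in B)) => //; first exact: mem0v.
by move=> c u v uB vB; rewrite memvD ?memvZ.
Qed.

End ConjugateEigenvalues.

(** * The trace form and Cartan's criterion *)
Section TraceForm.
Variables (C : numClosedFieldType) (n : nat).
Implicit Types (X Y Z x w : 'M[C]_n) (a b g : {vspace 'M[C]_n}).

(** The regular module [C^o] as codomain makes this linear form an argument of
    [linfun]. *)
Definition trace_form Y X : C^o := \tr (X *m Y).

Lemma trace_form_linear Y : linear (trace_form Y).
Proof.
move=> k A B; rewrite /trace_form mulmxDl -scalemxAl.
by rewrite mxtraceD mxtraceZ.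
Qed.

HB.instance Definition _ Y :=
  GRing.isLinear.Build C 'M[C]_n C^o _ (trace_form Y) (trace_form_linear Y).

Lemma trace_bracket_rotate X Y Z :
  \tr (X *m lie_bracket Y Z) = \tr (Y *m lie_bracket Z X).
Proof.
rewrite /lie_bracket !mulmxBr !linearB /= !mulmxA.
by congr (_ - _); [rewrite -mulmxA mxtrace_mulC | rewrite mxtrace_mulC mulmxA].
Qed.

Lemma trace_bracketL X Y Z :
  \tr (lie_bracket X Y *m Z) = \tr (X *m lie_bracket Y Z).
Proof. by rewrite [LHS]mxtrace_mulC [LHS]trace_bracket_rotate. Qed.

Lemma derived_trace_eq0 a b Y :
  (forall X1 X2, X1 \in a -> X2 \in b -> \tr (lie_bracket X1 X2 *m Y) = 0) ->
  forall X, X \in lie_bracketv a b -> \tr (X *m Y) = 0.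
Proof.
move=> H X Xab.
have sub : (lie_bracketv a b <= lker (linfun (trace_form Y)))%VS.
  by apply/lie_bracketv_subP => X1 X2 ? ?; rewrite memv_ker lfunE /= /trace_form H.
by move/subvP: sub => /(_ _ Xab); rewrite memv_ker lfunE => /eqP.
Qed.

Definition trace_orthogonal g b : {vspace 'M[C]_n} :=
  (g :&: \bigcap_(i < \dim b) lker (linfun (trace_form (vbasis b)`_i)))%VS.

Lemma trace_orthogonalP g b Z :
  reflect (Z \in g /\ forall Y, Y \in b -> \tr (Z *m Y) = 0)
    (Z \in trace_orthogonal g b).
Proof.
rewrite /trace_orthogonal memv_cap.
apply: (iffP andP) => -[Zg H]; split=> //.
  move=> Y Yb; rewrite (coord_vbasis Yb) mulmx_sumr linear_sum big1 // => i _.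
  rewrite -scalemxAr linearZ /=.
  have /subv_bigcapP/(_ i isT) :=
    subvv (\bigcap_(i < \dim b) lker (linfun (trace_form (vbasis b)`_i)))%VS.
  by move/subvP/(_ _ H); rewrite memv_ker lfunE /= /trace_form => /eqP->; rewrite mulr0.
rewrite memvE; apply/subv_bigcapP => i _; rewrite -memvE memv_ker lfunE /=.
by rewrite /trace_form H // vbasis_mem // mem_nth // size_tuple.
Qed.

Lemma ad_nilpotent x N w : x ^+ N = 0 -> iter (N + N) (lie_bracket x) w = 0.
Proof.
move=> xN.
have claim k i j : (N + N <= i + j + k)%N ->
    iter k (lie_bracket x) (x ^+ i *m w *m x ^+ j) = 0.
  elim: k i j => [|k IH] i j.
    rewrite addn0 => le; case: (leqP N i) => Ni /=.
      by rewrite -(subnK Ni) exprD xN mulr0 !mul0mx.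
    have Nj : (N <= j)%N.
      by rewrite leqNgt; apply/negP => jN; move: le; rewrite leqNgt -addnS leq_add // ltnW.
    by rewrite -(subnK Nj) exprD xN mulr0 !mulmx0.
  rewrite addnS => le; rewrite iterSr.
  have iterB u v : iter k (lie_bracket x) (u - v) =
     iter k (lie_bracket x) u - iter k (lie_bracket x) v.
    by elim: k {IH le} => //= k ->; rewrite linearB.
  have -> : lie_bracket x (x ^+ i *m w *m x ^+ j) =
      x ^+ i.+1 *m w *m x ^+ j - x ^+ i *m w *m x ^+ j.+1.
    by rewrite /lie_bracket exprS exprSr -![_ * _]/(_ *m _) !mulmxA.
  by rewrite iterB !IH ?subr0 // addnS addSn.
by have := claim (N + N)%N 0 0; rewrite expr0 mulmx1 mul1mx => ->.
Qed.

End TraceForm.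

(** The heart of Cartan's criterion: for [x] in the derived algebra of [b] and y
    given by [conjugate_eigenvalue_matrix], tr([s, t] y) = tr(s [t, y]) and
    [t, y] is again in the derived algebra, so tr(x y) = 0. *)
Lemma nilpotent_derived (C : numClosedFieldType) n (b : {vspace 'M[C]_n}) x :
  (lie_bracketv b b <= b)%VS ->
  (forall u v, u \in b -> v \in lie_bracketv b b -> \tr (u *m v) = 0) ->
  x \in lie_bracketv b b -> x ^+ n = 0.
Proof.
case: n b x => [|m] b x sub tr0 xD; first by apply/matrixP => -[].
have [y [xy0 yP]] := conjugate_eigenvalue_matrix x.
apply: xy0; apply: (derived_trace_eq0 _ xD) => u v ub vb.
rewrite trace_bracketL tr0 // lie_bracketC memvN.
apply: (yP _ _ sub _ v vb) => w wb; apply: memv_lie_bracket => //.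
exact: (subvP sub).
Qed.

Section SolvableTrace.
Variables (C : numClosedFieldType) (n : nat).
Implicit Types (X Y Z s t u : 'M[C]_n) (a b g : {vspace 'M[C]_n}).

Let std X : {linear 'cV[C]_n -> 'cV[C]_n} := mulmx X.

Lemma std_linear (v : 'cV[C]_n) k X Y : std (k *: X + Y) v = k *: std X v + std Y v.
Proof. by rewrite /std /= mulmxDl scalemxAl. Qed.

Lemma std_bracket X Y (v : 'cV[C]_n) :
  std (lie_bracket X Y) v = std X (std Y v) - std Y (std X v).
Proof. by rewrite /std /= /lie_bracket mulmxBl !mulmxA. Qed.

Lemma lie_theorem b (L : {vspace 'cV[C]_n}) :
  lie_solvable b -> (lie_bracketv b b <= b)%VS -> L != 0%VS ->
  (forall X v, X \in b -> v \in L -> X *m v \in L) ->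
  exists v, [/\ v \in L, v != 0 & forall X, X \in b -> exists l, X *m v = l *: v].
Proof.
move=> sol sub L0 bL; have vL := memv_pick L.
have [|||v [vL' v0 H]] :=
    lie_theorem_modulo std_linear std_bracket (U := 0%VS) sol sub _ _ vL.
- by move=> X u _; rewrite memv0 => /eqP->; rewrite linear0 mem0v.
- by move=> X u; apply: bL.
- by rewrite memv0 vpick0.
exists v; split=> //; first by rewrite memv0 in v0.
by move=> X /H[l]; rewrite memv0 subr_eq0 => /eqP ?; exists l.
Qed.

(** In an invariant flag provided by Lie's theorem the bracket acts by zero on
    each line, so that u [s, t] lowers the flag and is nilpotent. *)
Lemma solvable_trace_eq0 b u s t :
  lie_solvable b -> (lie_bracketv b b <= b)%VS ->
  u \in b -> s \in b -> t \in b -> \tr (u *m lie_bracket s t) = 0.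
Proof.
move=> sol sub ub sb tb.
pose A := u *m lie_bracket s t.
have flag m : exists U : {vspace 'cV[C]_n},
  [/\ (m <= \dim U)%N \/ U = fullv,
    forall X v, X \in b -> v \in U -> X *m v \in U &
    exists k, forall v, v \in U -> A ^+ k *m v = 0].
  elim: m => [|m [U [mU bU [k kU]]]].
    exists 0%VS; split; first by left.
      by move=> X v _; rewrite memv0 => /eqP->; rewrite mulmx0 mem0v.
    by exists 0 => v; rewrite memv0 => /eqP->; rewrite mulmx0.
  case: mU => [mU|Uf]; last by exists U; split=> //; [right | exists k].
  have [Uf|UF] := eqVneq U fullv; first by exists U; split=> //; [right | exists k].
  have [w wU] : exists w, w \notin U.
    apply/not_existsP => H; case/negP: UF; rewrite eqEsubv subvf; apply/subvP => v _.
    exact/negPn/negP/H.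
  have [|w' [_ w'U w'l]] := lie_theorem_modulo std_linear std_bracket sol sub
     bU _ (memvf w) wU.
    by move=> *; apply: memvf.
  have /= w'l' X : X \in b -> exists l, exists2 r, r \in U & X *m w' = r + l *: w'.
    by move=> /w'l[l Hl]; exists l, (X *m w' - l *: w'); rewrite ?subrK.
  exists (U + <[w']>)%VS; split.
  - left; rewrite (leq_ltn_trans mU) // ltnNge; apply/negP => le.
    have /eqP e : U == (U + <[w']>)%VS by rewrite eqEdim addvSl.
    by case/negP: w'U; rewrite e (subvP (addvSr _ _)) ?memv_line.
  - move=> X v Xb /memv_addP[a aU [_ /vlineP[c ->] ->]].
    have [l [r rU e]] := w'l' X Xb.
    rewrite mulmxDr -scalemxAr e scalerDr scalerA addrA memv_add ?memvZ ?memv_line //.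
    by rewrite memvD ?memvZ ?bU.
  exists k.+1 => v /memv_addP[a aU [_ /vlineP[c ->] ->]].
  have AU v' : v' \in U -> A *m v' \in U.
    move=> v'U; rewrite /A -mulmxA bU // /lie_bracket mulmxBl -!mulmxA.
    by rewrite memvB ?bU.
  rewrite exprSr -[_ * _]/(_ *m _) -mulmxA kU // mulmxDr memvD ?(AU a) //.
  rewrite -scalemxAr memvZ // /A -mulmxA bU //.
  have [l1 [r1 r1U e1]] := w'l' s sb; have [l2 [r2 r2U e2]] := w'l' t tb.
  rewrite /lie_bracket mulmxBl -!mulmxA e1 e2 !mulmxDr -!scalemxAr e1 e2.
  rewrite (_ : _ - _ = s *m r2 + l2 *: r1 - (t *m r1 + l1 *: r2)).
    by rewrite memvB ?memvD ?memvZ ?bU.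
  by vector_ring.
have [U [dU _ [k kU]]] := flag (\dim (fullv : {vspace 'cV[C]_n})).+1.
apply: (@mxtrace_nilpotent _ _ A k).
have Uf : U = fullv.
  case: dU => // le; have := leq_trans le (dimvS (subvf U)).
  by rewrite ltnn.
apply/matrixP => i j; have := kU (delta_mx j 0).
rewrite Uf memvf => /(_ isT) /matrixP /(_ i 0).
by rewrite -colE !mxE.
Qed.

(** Otherwise Lie's theorem for the adjoint action of [b] on its orthogonal,
    modulo [b], gives Z outside [b] such that b + CZ is a subalgebra.  The trace
    form vanishes between it and its derived algebra, so Cartan's criterion
    makes every element of that derived algebra nilpotent; those lying in [b]
    then have eigenvalue 0 on Z modulo [b], so the second derived algebra is
    contained in [b].  Hence b + CZ is solvable, against the maximality
    of [b]. *)
Lemma trace_orthogonal_borel g b : (lie_bracketv g g <= g)%VS ->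
  borel_subalgebra g b -> (trace_orthogonal g b <= b)%VS.
Proof.
move=> /lie_bracketv_subP gg [[bg sub] sol max].
have /lie_bracketv_subP bb := sub.
apply/subvP => Z0 Z0p; apply/negPn/negP => Z0b.
pose ad X : {linear 'M[C]_n -> 'M[C]_n} := lie_bracket X.
have ad_lin (v : 'M[C]_n) k X Y : ad (k *: X + Y) v = k *: ad X v + ad Y v.
  by rewrite /ad /= lie_bracketDZl.
have [|Z [Zp Zb Zl]] := lie_theorem_modulo ad_lin
   (fun X Y v => lie_bracket_jacobi X Y v) sol sub bb _ Z0p Z0b.
  move=> X v Xb /trace_orthogonalP[vg vb]; apply/trace_orthogonalP; split.
    by rewrite gg // (subvP bg).
  move=> Y Yb; rewrite /ad /= lie_bracketC mulNmx linearN /= trace_bracketL.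
  by rewrite vb ?oppr0 ?bb.
have /trace_orthogonalP[Zg tZ] := Zp.
pose b' := (b + <[Z]>)%VS.
have bb' : (b <= b')%VS by apply: addvSl.
have Zb' : Z \in b' by rewrite (subvP (addvSr _ _)) ?memv_line.
have b'P X : X \in b' -> exists x c, x \in b /\ X = x + c *: Z.
  by move=> /memv_addP[x xb [_ /vlineP[c ->] ->]]; exists x, c.
have b'Zb x : x \in b -> lie_bracket x Z \in b'.
  move=> xb; have [l lP] := Zl x xb.
  by rewrite -[lie_bracket x Z](subrK (l *: Z)) memv_add ?memvZ ?memv_line.
have brE x c y d : lie_bracket (x + c *: Z) (y + d *: Z) =
    lie_bracket x y + d *: lie_bracket x Z - c *: lie_bracket y Z.
  rewrite linearD linearZ /= !lie_bracketDl !lie_bracketZl lie_bracket_self.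
  by rewrite (lie_bracketC Z y); vector_ring.
have sub' : (lie_bracketv b' b' <= b')%VS.
  apply/lie_bracketv_subP => X Y /b'P[x [c [xb ->]]] /b'P[y [d [yb ->]]].
  have xyb' : lie_bracket x y \in b' by apply/(subvP bb')/bb.
  rewrite brE; apply: memvB; last exact/memvZ/b'Zb.
  by apply: memvD => //; exact/memvZ/b'Zb.
have b'g : (b' <= g)%VS by rewrite subv_add bg -memvE.
(* The form tr(u [s, t]) is invariant under rotation of u, s and t, so its
   vanishing on b' is checked for triples from b and Z. *)
have f1 u s t : u \in b' -> s \in b -> t \in b -> \tr (u *m lie_bracket s t) = 0.
  move=> /b'P[x [c [xb ->]]] sb tb.
  rewrite mulmxDl linearD /= (solvable_trace_eq0 sol sub) // -scalemxAl linearZ /=.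
  by rewrite tZ ?bb // mulr0 addr0.
have fZZ t : \tr (Z *m lie_bracket Z t) = 0.
  by rewrite 2!trace_bracket_rotate lie_bracket_self mulmx0 linear0.
have f2 u t : u \in b' -> t \in b -> \tr (u *m lie_bracket Z t) = 0.
  move=> /b'P[x [c [xb ->]]] tb.
  rewrite mulmxDl linearD /= -scalemxAl linearZ /= fZZ mulr0 addr0.
  by rewrite trace_bracket_rotate f1.
have f u s t : u \in b' -> s \in b' -> t \in b' -> \tr (u *m lie_bracket s t) = 0.
  move=> ub /b'P[x [c [xb ->]]] /b'P[y [d [yb ->]]].
  rewrite brE mulmxBr mulmxDr -!scalemxAr linearB linearD !linearZ /= f1 //.
  rewrite (lie_bracketC x) (lie_bracketC y) !mulmxN !linearN /= !f2 //.
  by rewrite !(oppr0, mulr0, scaler0, addr0).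
have tr0 u v : u \in b' -> v \in lie_bracketv b' b' -> \tr (u *m v) = 0.
  move=> ub vD; rewrite mxtrace_mulC; apply: derived_trace_eq0 vD => s t sb tb.
  by rewrite mxtrace_mulC f.
have nil x : x \in b -> x \in lie_bracketv b' b' -> lie_bracket x Z \in b.
  move=> xb xD; have xn := nilpotent_derived sub' tr0 xD.
  have [l lP] := Zl x xb.
  suff l0 : l = 0 by move: lP; rewrite l0 scale0r subr0.
  have pw k : iter k (lie_bracket x) Z - l ^+ k *: Z \in b.
    elim: k => [|k IH]; first by rewrite expr0 scale1r subrr mem0v.
    apply: (eq_memv (memvD (bb _ _ xb IH) (memvZ (l ^+ k) lP))).
    by rewrite linearB linearZ /= exprS; vector_ring.
  apply: contraNeq Zb => l0; have := pw (n + n)%N.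
  rewrite ad_nilpotent // sub0r memvN => lZ.
  by rewrite -[Z](scalerK (expf_neq0 (n + n) l0)) memvZ.
have solv : lie_solvable b'.
  apply: (@lie_solvable_iter _ _ _ 2); apply: lie_solvableS sol.
  apply/lie_bracketv_subP => X Y XD YD.
  have Db' := subvP sub'.
  have [Db|/subvPn[Z' Z'D Z'b]] := boolP (lie_bracketv b' b' <= b)%VS.
    by apply: bb; apply: (subvP Db).
  have [z [a [zb eZ']]] := b'P _ (Db' _ Z'D).
  have a0 : a != 0.
    by apply: contraNneq Z'b => a0; rewrite eZ' a0 scale0r addr0.
  have dec U : U \in lie_bracketv b' b' -> exists x c,
      [/\ x \in b, x \in lie_bracketv b' b' & U = x + c *: Z'].
    move=> UD; have [x [c [xb eU]]] := b'P _ (Db' _ UD).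
    exists (U - (c / a) *: Z'), (c / a); split; last by rewrite subrK.
      rewrite eU eZ' scalerDr scalerA divfK //.
      rewrite opprD addrACA subrr addr0 memvB ?memvZ //.
    by rewrite memvB ?memvZ.
  have [x [c [xb xD ->]]] := dec X XD; have [y [d [yb yD ->]]] := dec Y YD.
  have nZ' u : u \in b -> u \in lie_bracketv b' b' -> lie_bracket u Z' \in b.
    by move=> ub uD; rewrite eZ' linearD linearZ /= memvD ?memvZ ?nil // bb.
  rewrite linearD linearZ /= !lie_bracketDl !lie_bracketZl lie_bracket_self.
  rewrite (lie_bracketC Z' y) scaler0 addr0 scalerN.
  have xyb := bb _ _ xb yb.
  apply: memvD; last exact/memvZ/nZ'.
  by apply: memvB => //; exact/memvZ/nZ'.
have e := max b' (conj b'g sub') solv bb'.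
by case/negP: Zb; rewrite -e.
Qed.

End SolvableTrace.

(** * Eigenvectors of a Borel subalgebra *)
Section HermitianForm.
Variable C : numClosedFieldType.

Definition adjmx m p (A : 'M[C]_(m, p)) : 'M[C]_(p, m) := (map_mx Num.conj A)^T.

(** The standard Hermitian product, for matrices and column vectors alike. *)
Definition hdot m p (A B : 'M[C]_(m, p)) : C := \tr (A *m adjmx B).

Lemma adjmxK m p (A : 'M[C]_(m, p)) : adjmx (adjmx A) = A.
Proof. by apply/matrixP=> i j; rewrite !mxE conjCK. Qed.

Lemma adjmxM m p q (A : 'M[C]_(m, p)) (B : 'M[C]_(p, q)) :
  adjmx (A *m B) = adjmx B *m adjmx A.
Proof. by rewrite /adjmx map_mxM trmx_mul. Qed.

Lemma adjmxB m p (A B : 'M[C]_(m, p)) : adjmx (A - B) = adjmx A - adjmx B.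
Proof. by apply/matrixP=> i j; rewrite !mxE rmorphB. Qed.

Lemma adjmxD m p (A B : 'M[C]_(m, p)) : adjmx (A + B) = adjmx A + adjmx B.
Proof. by apply/matrixP=> i j; rewrite !mxE rmorphD. Qed.

Lemma adjmxZ m p c (A : 'M[C]_(m, p)) : adjmx (c *: A) = c^* *: adjmx A.
Proof. by apply/matrixP=> i j; rewrite !mxE rmorphM. Qed.

Lemma adjmx0 m p : adjmx (0 : 'M[C]_(m, p)) = 0.
Proof. by apply/matrixP=> i j; rewrite !mxE conjC0. Qed.

Lemma mxtrace_adj m (A : 'M[C]_m) : \tr (adjmx A) = (\tr A)^*.
Proof. by rewrite /mxtrace rmorph_sum; apply: eq_bigr => i _; rewrite !mxE. Qed.

Lemma hdotC m p (A B : 'M[C]_(m, p)) : hdot A B = (hdot B A)^*.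
Proof. by rewrite /hdot -mxtrace_adj adjmxM adjmxK. Qed.

Lemma hdotDl m p (A B D : 'M[C]_(m, p)) : hdot (A + B) D = hdot A D + hdot B D.
Proof. by rewrite /hdot mulmxDl linearD. Qed.

Lemma hdotZl m p c (A D : 'M[C]_(m, p)) : hdot (c *: A) D = c * hdot A D.
Proof. by rewrite /hdot -scalemxAl linearZ. Qed.

Lemma hdotZr m p c (A D : 'M[C]_(m, p)) : hdot A (c *: D) = c^* * hdot A D.
Proof. by rewrite [LHS]hdotC hdotZl rmorphM [hdot A D]hdotC. Qed.

Lemma hdotDr m p (A B D : 'M[C]_(m, p)) : hdot D (A + B) = hdot D A + hdot D B.
Proof. by rewrite [LHS]hdotC hdotDl rmorphD [hdot D A]hdotC [hdot D B]hdotC. Qed.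

Lemma hdotBl m p (A B D : 'M[C]_(m, p)) : hdot (A - B) D = hdot A D - hdot B D.
Proof. by rewrite /hdot mulmxBl linearB. Qed.

Lemma hdot_mull m p q (X : 'M[C]_(m, p)) (A : 'M[C]_(p, q)) B :
  hdot (X *m A) B = hdot A (adjmx X *m B).
Proof. by rewrite /hdot adjmxM adjmxK -mulmxA mxtrace_mulC -mulmxA. Qed.

Lemma hdot_eq0 m p (A : 'M[C]_(m, p)) : (hdot A A == 0) = (A == 0).
Proof.
apply/eqP/eqP => [H|->]; last by rewrite /hdot mul0mx linear0.
have e : hdot A A = \sum_i \sum_j A i j * (A i j)^*.
  by apply: eq_bigr => i _; rewrite mxE; apply: eq_bigr => j _; rewrite !mxE.
apply/matrixP => i j; rewrite mxE; move: H; rewrite e => /eqP.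
rewrite psumr_eq0 => [/allP/(_ i (mem_index_enum _))|k _]; last first.
  by apply: sumr_ge0 => l _; apply: mul_conjC_ge0.
rewrite /= psumr_eq0 => [/allP/(_ j (mem_index_enum _))|k _]; last exact: mul_conjC_ge0.
by rewrite /= mul_conjC_eq0 => /eqP.
Qed.

End HermitianForm.

Section OrthogonalComplement.
Variables (C : numClosedFieldType) (n : nat).
Implicit Types (X Y Z : 'M[C]_n) (U g : {vspace 'M[C]_n}).

Lemma exists_orthogonal U g : (U <= g)%VS -> U != g ->
  exists Z, [/\ Z \in g, Z != 0 & forall Y, Y \in U -> hdot Z Y = 0].
Proof.
move=> Ug UNg.
pose f Z : 'rV[C]_(\dim U) := \row_i hdot Z (vbasis U)`_i.
have flin : linear f.
  by move=> c A B; apply/rowP => i; rewrite !mxE hdotDl hdotZl.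
pose fmix := GRing.isLinear.Build C _ _ _ f flin.
pose fL : {linear 'M[C]_n -> 'rV[C]_(\dim U)} := HB.pack f fmix.
have dU : (\dim U < \dim g)%N.
  by rewrite ltnNge; apply: contra UNg => le; rewrite eqEdim Ug.
have dker : (0 < \dim (g :&: lker (linfun fL)))%N.
  have := limg_ker_dim (linfun fL) g => e.
  have le : (\dim (linfun fL @: g) <= \dim U)%N.
    by rewrite (leq_trans (dimvS (subvf _))) // dimvf /dim /= mul1n.
  by rewrite -(ltn_add2r (\dim (linfun fL @: g))) add0n e (leq_ltn_trans le).
have Z0 : vpick (g :&: lker (linfun fL)) != 0 by rewrite vpick0 -dimv_eq0 -lt0n.
exists (vpick (g :&: lker (linfun fL))).
have := memv_pick (g :&: lker (linfun fL)).
move: Z0; move: (vpick _) => Z Z0; rewrite memv_cap memv_ker lfunE => /andP[Zg /eqP fZ].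
split=> // Y YU; rewrite (coord_vbasis YU).
apply: (big_ind (fun Y => hdot Z Y = 0)) => [|A B eA eB|i _].
- by rewrite /hdot adjmx0 mulmx0 linear0.
- by rewrite hdotDr eA eB addr0.
- have /rowP/(_ i) := fZ; rewrite !mxE /= => e.
  by rewrite hdotZr e mulr0.
Qed.

Lemma riesz_representation g (mu : {scalar 'M[C]_n}) :
  exists2 H, H \in g & forall X, X \in g -> mu X = hdot X H.
Proof.
pose K := (g :&: lker (linfun mu))%VS.
have KP X : X \in K = (X \in g) && (mu X == 0).
  by rewrite memv_cap memv_ker lfunE.
have [Kg|KNg] := eqVneq K g.
  exists 0; first exact: mem0v.
  move=> X; rewrite -Kg KP => /andP[_ /eqP->].
  by rewrite /hdot adjmx0 mulmx0 linear0.
have [Z [Zg Z0 ZK]] := exists_orthogonal (capvSl g (lker (linfun mu))) KNg.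
have ZZ : hdot Z Z != 0 by rewrite hdot_eq0.
have muZ : mu Z != 0.
  apply: contraNneq Z0 => muZ; rewrite -hdot_eq0; apply/eqP/ZK.
  by rewrite -/K KP Zg muZ eqxx.
exists ((mu Z / hdot Z Z)^* *: Z) => [|X Xg]; first by rewrite memvZ.
rewrite hdotZr conjCK.
have : X - (mu X / mu Z) *: Z \in K.
  by rewrite KP memvB ?memvZ //= linearB scalarZ /= divfK // subrr.
move=> /ZK /(congr1 Num.conj); rewrite -hdotC conjC0 hdotBl hdotZl => /eqP.
rewrite subr_eq0 => /eqP ->; field.
by rewrite muZ ZZ.
Qed.

End OrthogonalComplement.

Section BorelEigenvectors.
Variables (C : numClosedFieldType) (n : nat).
Implicit Types (X Y Z : 'M[C]_n) (v w : 'cV[C]_n).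
Variables g b : {vspace 'M[C]_n}.
Hypothesis g_bracket : (lie_bracketv g g <= g)%VS.
Hypothesis g_adj : forall X, X \in g -> adjmx X \in g.
Hypothesis b_borel : borel_subalgebra g b.

Let bg X : X \in b -> X \in g.
Proof. by case: b_borel => -[/subvP h _] _ _; apply: h. Qed.

Let bb X Y : X \in b -> Y \in b -> lie_bracket X Y \in b.
Proof. by case: b_borel => -[_ /lie_bracketv_subP h] _ _; apply: h. Qed.

Let gg X Y : X \in g -> Y \in g -> lie_bracket X Y \in g.
Proof. by move/lie_bracketv_subP: g_bracket; apply. Qed.

(** This is b^*: the adjoint being conjugate-linear, the span of the adjoints of
    a basis is the set of all adjoints. *)
Definition adj_space : {vspace 'M[C]_n} := <<[seq adjmx Y | Y <- vbasis b]>>%VS.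

Lemma mem_adj_space X : (X \in adj_space) = (adjmx X \in b).
Proof.
have sub Y : Y \in b -> adjmx Y \in adj_space.
  move=> Yb; rewrite (coord_vbasis Yb).
  apply: (big_ind (fun Y => adjmx Y \in adj_space)) => [|A B eA eB|i _].
  - by rewrite adjmx0 mem0v.
  - by rewrite adjmxD memvD.
  - by rewrite adjmxZ memvZ // memv_span // map_f // mem_nth // size_tuple.
apply/idP/idP => [/coord_span ->|/sub]; last by rewrite adjmxK.
apply: (big_ind (fun Y => adjmx Y \in b)) => [|A B eA eB|i _].
- by rewrite adjmx0 mem0v.
- by rewrite adjmxD memvD.
- rewrite adjmxZ memvZ //.
  have : (in_tuple [seq adjmx Y | Y <- vbasis b])`_i
      \in [seq adjmx Y | Y <- vbasis b].
    by apply: mem_nth; rewrite size_map size_tuple.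
  by case/mapP => Y /vbasis_mem Yb ->; rewrite adjmxK.
Qed.

(** An element of [g] orthogonal to b + b^* for the Hermitian product is
    orthogonal to [b] for the trace form, hence belongs to [b]; being orthogonal
    to itself, it vanishes. *)
Lemma borel_decomposition : (g <= b + adj_space)%VS.
Proof.
have Ug : (b + adj_space <= g)%VS.
  rewrite subv_add; apply/andP; split; apply/subvP => X; first exact: bg.
  by rewrite mem_adj_space => /bg/g_adj; rewrite adjmxK.
have [<-|UNg] := eqVneq (b + adj_space)%VS g; first exact: subvv.
have [Z [Zg + H]] := exists_orthogonal Ug UNg; case/negP; rewrite -hdot_eq0; apply/eqP.
have perp := subvP (trace_orthogonal_borel g_bracket b_borel).
have Zb : Z \in b.
  apply: perp; apply/trace_orthogonalP; split=> // Y Yb.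
  have := H (adjmx Y); rewrite /hdot adjmxK; apply.
  by apply: (subvP (addvSr _ _)); rewrite mem_adj_space adjmxK.
by apply: H; apply: (subvP (addvSl _ _)).
Qed.

Definition borel_eigenvector v := forall X, X \in b -> exists l, X *m v = l *: v.

Hypothesis g_irr : forall P : {vspace 'cV[C]_n},
  (forall X v, X \in g -> v \in P -> X *m v \in P) -> P = 0%VS \/ P = fullv.

(** If v and w are orthogonal, let P be maximal among the subspaces that contain
    [v], are orthogonal to [w], and are sent by [g] into P + b^* P.  The last
    property passes from P to P + b^* P since XY = [X, Y] + YX, and so does
    orthogonality to [w], which is an eigenvector of the adjoints of b^*.  So P
    is stable under [g], and it is neither 0 nor the whole space. *)
Lemma borel_eigenvectors_not_orthogonal v w : v != 0 -> w != 0 ->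
  borel_eigenvector v -> borel_eigenvector w -> hdot v w != 0.
Proof.
move=> v0 w0 bv bw; apply/eqP => vw.
pose S (P : {vspace 'cV[C]_n}) : {vspace 'cV[C]_n} :=
  (P + <<[seq X *m u | X <- vbasis adj_space, u <- vbasis P]>>)%VS.
have PS (P : {vspace 'cV[C]_n}) u : u \in P -> u \in S P by apply/subvP/addvSl.
have adjS (P : {vspace 'cV[C]_n}) X u : X \in adj_space -> u \in P -> X *m u \in S P.
  move=> Xa uP; apply: (subvP (addvSr _ _)).
  rewrite (coord_vbasis uP) mulmx_sumr; apply: memv_suml => i _.
  rewrite -scalemxAr memvZ // (coord_vbasis Xa) mulmx_suml; apply: memv_suml => j _.
  rewrite -scalemxAl memvZ //; apply: memv_span; apply/allpairsP.
  exists ((vbasis adj_space)`_j, (vbasis P)`_i) => /=.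
  by split=> //; apply: mem_nth; rewrite size_tuple.
have Sind (P Q : {vspace 'cV[C]_n}) : (forall u, u \in P -> u \in Q) ->
    (forall X u, X \in adj_space -> u \in P -> X *m u \in Q) -> (S P <= Q)%VS.
  move=> PQ aQ; rewrite subv_add; apply/andP; split; first exact/subvP.
  by apply/span_subvP => _ /allpairsP[[X u] /= [/vbasis_mem Xa /vbasis_mem uP ->]]; apply: aQ.
pose good (P : {vspace 'cV[C]_n}) := [/\ v \in P, forall u, u \in P -> hdot u w = 0 &
  forall X u, X \in g -> u \in P -> X *m u \in S P].
have orth_space : exists w_orth : {vspace 'cV[C]_n}, forall u, (u \in w_orth) = (hdot u w == 0).
  pose f (u : 'cV[C]_n) : C^o := hdot u w.
  have flin : linear f by move=> c A B; rewrite /f hdotDl hdotZl.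
  pose fmix := GRing.isLinear.Build C _ _ _ f flin.
  pose fL : {linear 'cV[C]_n -> C^o} := HB.pack f fmix.
  by exists (lker (linfun fL)) => u; rewrite memv_ker lfunE.
have [w_orth w_orthP] := orth_space.
have goodS P : good P -> good (S P).
  move=> [vP Pw gP]; split; first exact: PS.
    move=> u uS; apply/eqP; rewrite -w_orthP; apply: (subvP _ _ uS).
    apply: Sind => [u' /Pw|X u' Xa u'P].
      by rewrite w_orthP => ->.
    rewrite mem_adj_space in Xa; have [l lw] := bw _ Xa.
    by rewrite w_orthP hdot_mull lw hdotZr Pw // mulr0.
  move=> X u Xg uS.
  have : (S P <= linfun (mulmx X) @^-1: S (S P))%VS.
    apply: Sind => [u' u'P|Y u' Ya u'P]; rewrite -memv_preim lfunE /=.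
      by apply: PS; apply: gP.
    have Yg : Y \in g by rewrite mem_adj_space in Ya; rewrite -[Y]adjmxK g_adj ?bg.
    have -> : X *m (Y *m u') = lie_bracket X Y *m u' + Y *m (X *m u').
      by rewrite /lie_bracket mulmxBl !mulmxA subrK.
    rewrite memvD //; first by apply/PS/gP => //; apply: gg.
    exact/adjS/gP.
  by move/subvP/(_ _ uS); rewrite -memv_preim lfunE.
have good_v : good <[v]>%VS.
  split; first exact: memv_line.
    by move=> _ /vlineP[c ->]; rewrite hdotZl vw mulr0.
  move=> X _ Xg /vlineP[c ->]; rewrite -scalemxAr memvZ //.
  have /memv_addP[X1 X1b [X2 X2a ->]] := subvP borel_decomposition _ Xg.
  rewrite mulmxDl; have [l ->] := bv X1 X1b.
  by apply: memvD; [apply/PS/memvZ/memv_line | apply/adjS/memv_line].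
have [P [vP Pw gP] fixP] : exists2 P, good P & (S P <= P)%VS.
  have : forall k, exists2 P, good P & (k <= \dim P)%N \/ (S P <= P)%VS.
    elim=> [|k [P gP [kP|]]]; first by exists <[v]>%VS => //; left.
      case: (boolP (S P <= P)%VS) => SP; first by exists P => //; right.
      exists (S P); first exact: goodS.
      left; rewrite (leq_ltn_trans kP) // ltnNge; apply: contra SP => le.
      by have /eqP <- : P == S P by rewrite eqEdim addvSl.
    by exists P => //; right.
  move=> /(_ (\dim (fullv : {vspace 'cV[C]_n})).+1) [P gP [le|SP]]; last by exists P.
  by have := leq_trans le (dimvS (subvf P)); rewrite ltnn.
have [P0|Pf] : P = 0%VS \/ P = fullv.
- by apply: g_irr => X u Xg uP; apply/(subvP fixP)/gP.
- by move: vP; rewrite P0 memv0 (negbTE v0).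
by case/negP: w0; rewrite -hdot_eq0 Pw // Pf memvf.
Qed.

(** For an eigenvector [v] of [b] this is the weight of [v] on [b]; it makes
    sense on all matrices and is compatible with adjoints. *)
Definition weight v X : C^o := hdot (X *m v) v / hdot v v.

Lemma weight_linear v : linear (weight v).
Proof.
move=> c X Y; rewrite /weight mulmxDl -scalemxAl hdotDl hdotZl.
by rewrite mulrDl -mulrA.
Qed.

HB.instance Definition _ v :=
  GRing.isLinear.Build C 'M[C]_n C^o _ (weight v) (weight_linear v).

Lemma weightP v X : v != 0 -> borel_eigenvector v -> X \in b ->
  X *m v = weight v X *: v.
Proof.
move=> v0 bv Xb; rewrite /weight; have [l ->] := bv X Xb.
by rewrite hdotZl mulfK // hdot_eq0.
Qed.

Lemma weight_adj v X : weight v (adjmx X) = (weight v X)^*.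
Proof.
have e : (hdot v v)^* = hdot v v by rewrite -hdotC.
by rewrite /weight hdot_mull adjmxK hdotC [RHS]rmorphM fmorphV /= e.
Qed.

(** The matrix K representing the weight exists by Riesz, and is Hermitian since
    the weight is compatible with adjoints.  As the weight kills [b, b], the
    invariance of the trace form places [b, K] in the orthogonal of [b], hence
    in [b]; so b + CK is solvable, and K is in [b] by maximality. *)
Lemma weight_representative v : v != 0 -> borel_eigenvector v ->
  exists K, [/\ K \in b, adjmx K = K &
    forall X, X \in g -> weight v X = \tr (X *m K)].
Proof.
move=> v0 bv; have [H Hg muH] := riesz_representation g (weight v).
have Kg : adjmx H \in g by apply: g_adj.
pose K := adjmx H.
have muK X : X \in g -> weight v X = \tr (X *m K) by move/muH.
have Kadj : adjmx K = K.
  have tD Y : Y \in g -> \tr (Y *m (adjmx K - K)) = 0.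
    move=> Yg; rewrite mulmxBr linearB /= -muK // -[Y]adjmxK weight_adj muK ?g_adj //.
    by rewrite -mxtrace_adj adjmxM mxtrace_mulC subrr.
  have skew : adjmx (adjmx K - K) = - (adjmx K - K).
    by rewrite adjmxB adjmxK opprB.
  apply/eqP; rewrite -subr_eq0 -hdot_eq0 /hdot skew mulmxN linearN /= tD ?oppr0 //.
  by rewrite memvB ?g_adj.
exists K; split=> //.
have perp := subvP (trace_orthogonal_borel g_bracket b_borel).
have bK Y : Y \in b -> lie_bracket Y K \in b.
  move=> Yb; apply: perp; apply/trace_orthogonalP; split; first exact: gg (bg Yb) Kg.
  move=> X Xb; rewrite mxtrace_mulC -trace_bracketL -muK ?bg ?bb //.
  rewrite /weight /lie_bracket mulmxBl -!mulmxA.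
  have [l1 e1] := bv X Xb; have [l2 e2] := bv Y Yb.
  rewrite e1 e2 -!scalemxAr e1 e2 !scalerA (mulrC l2 l1) subrr.
  by rewrite /hdot mul0mx linear0 mul0r.
pose b' := (b + <[K]>)%VS.
case: b_borel => -[_ sub] sol max.
have Db' : (lie_bracketv b' b' <= b)%VS.
  apply/lie_bracketv_subP => X Y /memv_addP[x xb [_ /vlineP[c ->] ->]].
  move=> /memv_addP[y yb [_ /vlineP[d ->] ->]].
  rewrite linearD linearZ /= !lie_bracketDl !lie_bracketZl lie_bracket_self.
  rewrite (lie_bracketC K y) scaler0 addr0.
  apply: memvD; last exact/memvZ/bK.
  by apply: memvD; [apply: bb | rewrite memvZ // memvN bK].
rewrite -(max b') ?(subvP (addvSr _ _)) ?memv_line ?addvSl //.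
  by split; [rewrite subv_add -memvE Kg andbT; apply/subvP/bg
            | apply: (subv_trans Db'); apply: addvSl].
by apply: (@lie_solvable_iter _ _ _ 1); apply: lie_solvableS sol.
Qed.

(** Comparing <X v, w> with <v, X^* w> shows that the two weights agree where
    both [X] and its adjoint are in [b].  The difference of their Hermitian
    representatives is such an [X] and is then orthogonal to itself, so the
    weights are equal and the projection of [w] orthogonally to [v] is again an
    eigenvector of [b]. *)
Theorem borel_eigenvector_unique v w : v != 0 -> w != 0 ->
  borel_eigenvector v -> borel_eigenvector w -> w \in <[v]>%VS.
Proof.
move=> v0 w0 bv bw.
have vw := borel_eigenvectors_not_orthogonal v0 w0 bv bw.
have [K [Kb Ka Kv]] := weight_representative v0 bv.
have [K' [Kb' Ka' Kw]] := weight_representative w0 bw.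
have eqt X : X \in b -> adjmx X \in b -> weight v X = weight w X.
  move=> Xb Xab; apply: (mulIf vw).
  rewrite -hdotZl -weightP // hdot_mull (weightP w0) // hdotZr.
  by rewrite weight_adj conjCK.
have eqK : K = K'.
  apply/eqP; rewrite -subr_eq0 -hdot_eq0 /hdot adjmxB Ka Ka'.
  have Db : K - K' \in b by rewrite memvB.
  rewrite mulmxBr linearB /= -Kv ?bg // -Kw ?bg // eqt ?subrr //.
  by rewrite adjmxB Ka Ka'.
have eqw X : X \in b -> weight w X = weight v X.
  by move=> Xb; rewrite Kw ?bg // Kv ?bg // eqK.
pose u := w - (hdot w v / hdot v v) *: v.
have bu : borel_eigenvector u.
  move=> X Xb; exists (weight v X).
  rewrite /u mulmxBr -scalemxAr (weightP w0) // (weightP v0) // eqw //.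
  by rewrite scalerBr !scalerA mulrC.
have uv : hdot u v = 0.
  by rewrite /u hdotBl hdotZl divfK ?subrr // hdot_eq0.
have [u0|u0] := eqVneq u 0.
  by apply/vlineP; exists (hdot w v / hdot v v); apply/eqP; rewrite -subr_eq0 -/u u0.
by have := borel_eigenvectors_not_orthogonal u0 v0 bu bv; rewrite uv eqxx.
Qed.

End BorelEigenvectors.

(** * Matrix norms and derivatives *)
Lemma exists_scalar (F : fieldType) (V : lmodType F) (f : V -> F) :
  (forall c u v, f (c *: u + v) = c * f u + f v) ->
  exists T : {scalar V}, forall v, T v = f v.
Proof.
move=> flin; pose fmix := GRing.isLinear.Build F V F *%R f flin.
pose T : {scalar V} := HB.pack f fmix.
by exists T.
Qed.

Section EntrySumNorm.
Variable R : realType.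

(** This norm is submultiplicative, unlike the supremum norm on matrices. *)
Definition mxnorm1 m p (A : 'M[R]_(m, p)) : R := \sum_i \sum_j `|A i j|.

Lemma mxnorm1_ge0 m p (A : 'M[R]_(m, p)) : 0 <= mxnorm1 A.
Proof. by apply: sumr_ge0 => i _; apply: sumr_ge0. Qed.

Lemma ler_mxnorm1_entry m p (A : 'M[R]_(m, p)) i j : `|A i j| <= mxnorm1 A.
Proof.
rewrite /mxnorm1 (bigD1 i) //= (bigD1 j) //= -addrA lerDl addr_ge0 //.
  by apply: sumr_ge0.
by apply: sumr_ge0 => k _; apply: sumr_ge0.
Qed.

Lemma mxnorm1_lt m p (A : 'M[R]_(m, p)) d : 0 < d ->
  (forall i j, `|A i j| <= d / (m * p).+1%:R) -> mxnorm1 A < d.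
Proof.
move=> d0 Ad.
apply: le_lt_trans (_ : \sum_(i < m) \sum_(j < p) (d / (m * p).+1%:R) < d).
  by apply: ler_sum => i _; apply: ler_sum.
rewrite !sumr_const !card_ord -mulrnA -[_ *+ (p * m)]mulr_natr mulrAC ltr_pdivrMr ?ltr0n //.
by rewrite ltr_pM2l // ltr_nat mulnC.
Qed.

Lemma mxnorm1_0 m p : mxnorm1 (0 : 'M[R]_(m, p)) = 0.
Proof. by rewrite /mxnorm1 big1 // => i _; rewrite big1 // => j _; rewrite mxE normr0. Qed.

Lemma ler_mxnorm1D m p (A B : 'M[R]_(m, p)) : mxnorm1 (A + B) <= mxnorm1 A + mxnorm1 B.
Proof.
rewrite /mxnorm1 -big_split; apply: ler_sum => i _ /=.
by rewrite -big_split; apply: ler_sum => j _ /=; rewrite mxE ler_normD.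
Qed.

Lemma mxnorm1Z m p c (A : 'M[R]_(m, p)) : mxnorm1 (c *: A) = `|c| * mxnorm1 A.
Proof.
rewrite /mxnorm1 mulr_sumr; apply: eq_bigr => i _.
by rewrite mulr_sumr; apply: eq_bigr => j _; rewrite mxE normrM.
Qed.

Lemma mxnorm1N m p (A : 'M[R]_(m, p)) : mxnorm1 (- A) = mxnorm1 A.
Proof. by rewrite -scaleN1r mxnorm1Z normrN1 mul1r. Qed.

Lemma mxnorm1_distC m p (A B : 'M[R]_(m, p)) : mxnorm1 (A - B) = mxnorm1 (B - A).
Proof. by rewrite -mxnorm1N opprB. Qed.

Lemma ler_mxnorm1M m p q (A : 'M[R]_(m, p)) (B : 'M[R]_(p, q)) :
  mxnorm1 (A *m B) <= mxnorm1 A * mxnorm1 B.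
Proof.
rewrite {1 2}/mxnorm1 mulr_suml; apply: ler_sum => i _.
apply: le_trans (_ : \sum_j \sum_k `|A i k| * `|B k j| <= _).
  apply: ler_sum => j _; rewrite mxE; apply: le_trans (ler_norm_sum _ _ _) _.
  by apply: ler_sum => k _; rewrite normrM.
rewrite exchange_big /= mulr_suml; apply: ler_sum => k _.
rewrite -mulr_sumr ler_wpM2l // /mxnorm1 (bigD1 k) //= lerDl.
by apply: sumr_ge0 => l _; apply: sumr_ge0.
Qed.

Lemma ler_mxnorm1X n (A : 'M[R]_n) k :
  mxnorm1 (A ^+ k) <= mxnorm1 (1%:M : 'M[R]_n) * mxnorm1 A ^+ k.
Proof.
elim: k => [|k IH]; first by rewrite !expr0 mulr1.
rewrite exprSr exprS; apply: le_trans (ler_mxnorm1M _ _) _.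
by rewrite (mulrC (mxnorm1 A)) mulrA ler_wpM2r // mxnorm1_ge0.
Qed.

Lemma functional_entries n (T : {scalar 'M[R]_n}) M :
  T M = \sum_i \sum_j M i j * T (delta_mx i j).
Proof.
rewrite {1}(matrix_sum_delta M) linear_sum; apply: eq_bigr => i _.
by rewrite linear_sum; apply: eq_bigr => j _; rewrite scalarZ.
Qed.

Lemma functional_bound n (T : {scalar 'M[R]_n}) :
  exists2 c, 0 < c & forall M, `|T M| <= c * mxnorm1 M.
Proof.
exists (1 + \sum_i \sum_j `|T (delta_mx i j)|).
  by rewrite ltr_wpDr // sumr_ge0 // => i _; apply: sumr_ge0.
move=> M; rewrite functional_entries mulrDl.
apply: le_trans (ler_norm_sum _ _ _) _; rewrite mulr_suml.
apply: ler_wpDl; first by rewrite mul1r mxnorm1_ge0.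
apply: ler_sum => i _; apply: le_trans (ler_norm_sum _ _ _) _.
rewrite mulr_suml; apply: ler_sum => j _.
by rewrite normrM mulrC ler_wpM2l // ler_mxnorm1_entry.
Qed.

End EntrySumNorm.

Lemma cvg_fin_sum (R : realType) (T : Type) (F : set_system T) {FF : Filter F}
    (I : finType) (f : I -> T -> R) (l : I -> R) :
  (forall i, f i x @[x --> F] --> l i) ->
  \sum_i f i x @[x --> F] --> \sum_i l i.
Proof.
move=> fl; elim: (index_enum I) => [|i r IH].
  by rewrite big_nil; under eq_fun do rewrite big_nil; apply: cvg_cst.
rewrite big_cons; under eq_fun do rewrite big_cons.
exact: cvgD.
Qed.

Section MatrixDerivative.
Variable R : realType.

(** Derivatives are taken entrywise, which reduces them to real functions. *)
Definition mxderive m p (F : R -> 'M[R]_(m, p)) (t : R) (D : 'M[R]_(m, p)) :=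
  forall i j, is_derive t (1 : R) (fun s => F s i j) (D i j).

Lemma is_derive_fin_sum m (h : 'I_m -> R -> R) (t : R) (dh : 'I_m -> R) :
  (forall i, is_derive t (1 : R) (h i) (dh i)) ->
  is_derive t (1 : R) (fun s => \sum_i h i s) (\sum_i dh i).
Proof.
move=> H; have := is_derive_sum H.
by rewrite (_ : \sum_(i < m) h i = fun s => \sum_i h i s) // funeqE => s; rewrite fct_sumE.
Qed.

Lemma mxderiveM m p q (F : R -> 'M[R]_(m, p)) (G : R -> 'M[R]_(p, q)) t D E :
  mxderive F t D -> mxderive G t E ->
  mxderive (fun s => F s *m G s) t (D *m G t + F t *m E).
Proof.
move=> FD GE i j; rewrite mxE [X in X + _]mxE [X in _ + X]mxE -big_split /=.
rewrite (_ : (fun s => _) = fun s => \sum_k F s i k * G s k j); last first.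
  by apply/funext => s; rewrite mxE.
apply: is_derive_fin_sum => k.
apply: (is_derive_eq (is_deriveM (FD i k) (GE k j))).
by rewrite /GRing.scale /=; ring.
Qed.

Lemma mxderive_cst m p (A : 'M[R]_(m, p)) t : mxderive (fun=> A) t 0.
Proof. by move=> i j; rewrite mxE; apply: is_derive_cst. Qed.

Lemma mxderive_const m p (F : R -> 'M[R]_(m, p)) s t :
  (forall x, mxderive F x 0) -> F s = F t.
Proof.
move=> F0; apply/matrixP => i j.
apply: (@is_derive_0_is_cst _ (fun s => F s i j)) => x.
by have := F0 x i j; rewrite mxE.
Qed.

Lemma mxderive_affine m p (F : R -> 'M[R]_(m, p)) (a c t : R) D :
  mxderive F (a * t + c) D -> mxderive (fun s => F (a * s + c)) t (a *: D).
Proof.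
move=> FD i j; rewrite mxE mulrC.
have da : is_derive t (1 : R) (fun s => a * s + c) a.
  apply: (is_derive_eq (is_deriveD (is_deriveZ a (is_derive_id t 1)) (is_derive_cst c t 1))).
  by rewrite addr0 /GRing.scale /= mulr1.
exact: (@is_derive1_comp _ (fun s => F s i j) (fun s => a * s + c) t _ _ (FD i j) da).
Qed.

Lemma mxderive_functional n (T : {scalar 'M[R]_n}) F t D :
  mxderive F t D -> is_derive t (1 : R) (fun s => T (F s)) (T D).
Proof.
move=> FD; rewrite functional_entries.
rewrite (_ : (fun s => _) = fun s => \sum_i \sum_j F s i j * T (delta_mx i j)); last first.
  by apply/funext => s; rewrite functional_entries.
apply: is_derive_fin_sum => i; apply: is_derive_fin_sum => j.
apply: (is_derive_eq (is_deriveM (FD i j) (is_derive_cst (T (delta_mx i j)) t 1))).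
by rewrite scaler0 add0r /GRing.scale /= mulrC.
Qed.

Lemma mxderive_functional_eq0 n (T : {scalar 'M[R]_n}) F t D :
  mxderive F t D -> (forall s, T (F s) = 0) -> T D = 0.
Proof.
move=> /(mxderive_functional T) TD T0.
have e : (fun s => T (F s)) = cst 0 by apply/funext => s; rewrite T0.
by rewrite e in TD; rewrite -(@derive_val _ _ _ _ _ _ _ TD) derive_cst.
Qed.

End MatrixDerivative.

(** * The matrix exponential *)
Section MatrixExponential.
Variables (R : realType) (n : nat).
Implicit Types (A X Y M : 'M[R]_n) (t : R).

(** The shift by [m] covers the derived series, needed to differentiate the
    power series term by term. *)
Lemma cvg_exp_entries A m i j (x : R) :
  cvgn (pseries (fun k => (k`!%:R)^-1 * (A ^+ (k + m)) i j) x).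
Proof.
apply: normed_cvg; rewrite /normed_series_of /=.
pose c := mxnorm1 (1%:M : 'M[R]_n) * mxnorm1 A ^+ m.
have c0 : 0 <= c by rewrite mulr_ge0 ?exprn_ge0 ?mxnorm1_ge0.
have y0 : 0 <= mxnorm1 A * `|x| by rewrite mulr_ge0 ?mxnorm1_ge0.
have ge0 k : 0 <= (c *: exp_coeff (mxnorm1 A * `|x|)) k.
  by apply: mulr_ge0 => //; apply: exp_coeff_ge0.
have le k : `|(k`!%:R)^-1 * (A ^+ (k + m)) i j * x ^+ k| <=
    (c *: exp_coeff (mxnorm1 A * `|x|)) k.
  apply: le_trans (_ : c * ((mxnorm1 A * `|x|) ^+ k / k`!%:R) <= _) => //.
  rewrite normrM normrM normrX ger0_norm ?invr_ge0 ?ler0n // exprMn.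
  have -> : c * (mxnorm1 A ^+ k * `|x| ^+ k / k`!%:R) =
     (k`!%:R)^-1 * (c * mxnorm1 A ^+ k) * `|x| ^+ k by ring.
  rewrite ler_wpM2r ?exprn_ge0 // ler_wpM2l ?invr_ge0 ?ler0n //.
  apply: le_trans (ler_mxnorm1_entry _ _ _) _; apply: le_trans (ler_mxnorm1X _ _) _.
  by rewrite addnC exprD mulrA.
apply: (series_le_cvg _ ge0 le) => [k|]; first exact: normr_ge0.
by apply: is_cvg_seriesZ; apply: is_cvg_series_exp_coeff.
Qed.

Lemma cvg_expmx_entry A i j :
  series (fun k => (k`!%:R)^-1 * (A ^+ k) i j) @ \oo --> expmx A i j.
Proof.
rewrite mxE; have := @cvg_exp_entries A 0 i j 1.
suff -> : pseries (fun k => (k`!%:R)^-1 * (A ^+ (k + 0)) i j) (1 : R) =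
    series (fun k => (k`!%:R)^-1 * (A ^+ k) i j) by [].
congr series; apply/funext => k /=; by rewrite addn0 expr1n mulr1.
Qed.

(** Properties of the exponential that are linear in it are read off the powers
    of [A] through this lemma. *)
Lemma expmx_functional (T : {scalar 'M[R]_n}) A :
  series (fun k => (k`!%:R)^-1 * T (A ^+ k)) @ \oo --> T (expmx A).
Proof.
rewrite functional_entries.
have -> : series (fun k => (k`!%:R)^-1 * T (A ^+ k)) = fun N =>
    \sum_i \sum_j series (fun k => (k`!%:R)^-1 * (A ^+ k) i j) N * T (delta_mx i j).
  apply/funext => N; rewrite /series /=.
  under [RHS]eq_bigr do under eq_bigr do rewrite mulr_suml.
  under [RHS]eq_bigr do rewrite exchange_big /=.
  rewrite exchange_big /=; apply: eq_bigr => k _.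
  rewrite functional_entries mulr_sumr; apply: eq_bigr => i _.
  by rewrite mulr_sumr; apply: eq_bigr => j _; rewrite mulrA.
apply: cvg_fin_sum => i; apply: cvg_fin_sum => j.
by apply: cvgMr_tmp; apply: cvg_expmx_entry.
Qed.

Lemma expmx_functional_eq0 (T : {scalar 'M[R]_n}) A :
  (forall k, T (A ^+ k) = 0) -> T (expmx A) = 0.
Proof.
move=> T0; have /cvg_lim <- // := @expmx_functional T A.
rewrite (_ : series _ = cst 0) ?lim_cst //.
by apply/funext => N; rewrite /series /= big1 // => k _; rewrite T0 mulr0.
Qed.

Lemma expmx_comm A Y : A *m Y = Y *m A -> A *m expmx Y = expmx Y *m A.
Proof.
move=> AY; apply/eqP; rewrite -subr_eq0; apply/eqP/matrixP => i j; rewrite [RHS]mxE.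
have [|T TE] := exists_scalar (f := fun M : 'M[R]_n => (A *m M - M *m A) i j).
  by move=> c M N; rewrite mulmxDr mulmxDl -scalemxAr -scalemxAl !mxE; ring.
rewrite -TE; apply: expmx_functional_eq0 => k; rewrite TE.
suff -> : A *m Y ^+ k = Y ^+ k *m A by rewrite subrr mxE.
elim: k => [|k IH]; first by rewrite expr0 mulmx1 mul1mx.
by rewrite exprS -![_ * _]/(_ *m _) mulmxA AY -mulmxA IH mulmxA.
Qed.

Lemma expmx_image (f : {linear 'M[R]_n -> 'M[R]_n}) A Y :
  (forall k, f (A ^+ k) = Y ^+ k) -> f (expmx A) = expmx Y.
Proof.
move=> fA; apply/matrixP => i j.
have [|T TE] := exists_scalar (f := fun M : 'M[R]_n => f M i j).
  by move=> c M N; rewrite linearP !mxE.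
rewrite -TE; have := @expmx_functional T A.
rewrite (_ : series _ = series (fun k => (k`!%:R)^-1 * (Y ^+ k) i j)).
  by move=> /cvg_lim <- //; apply: cvg_lim => //; apply: cvg_expmx_entry.
by congr series; apply/funext => k /=; rewrite TE fA.
Qed.

Lemma expr_scalemx X t k : (t *: X) ^+ k = t ^+ k *: X ^+ k.
Proof.
elim: k => [|k IH]; first by rewrite !expr0 scale1r.
by rewrite !exprS IH -![_ * _]/(_ *m _) -scalemxAl -scalemxAr scalerA.
Qed.

Lemma mxderive_expmx X t :
  mxderive (fun s => expmx (s *: X)) t (X *m expmx (t *: X)).
Proof.
move=> i j.
pose c m k : R := (k`!%:R)^-1 * (X ^+ (k + m)) i j.
have dc m : pseries_diffs (c m) = c m.+1.
  apply/funext => k; rewrite /pseries_diffs /c factS natrM invfM mulrA mulrA.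
  by rewrite divff ?mul1r ?addSnnS // pnatr_eq0.
have e s : expmx (s *: X) i j = limn (pseries (c 0) s).
  rewrite mxE; congr (limn _); congr series; apply/funext => k /=.
  by rewrite /c addn0 expr_scalemx mxE; ring.
have e1 : (X *m expmx (t *: X)) i j = limn (pseries (c 1) t).
  rewrite mxE; apply/esym/cvg_lim => //.
  have -> : pseries (c 1) t = fun N =>
    \sum_l X i l * series (fun k => (k`!%:R)^-1 * ((t *: X) ^+ k) l j) N.
    apply/funext => N; rewrite /pseries /series /=.
    under [RHS]eq_bigr do rewrite mulr_sumr.
    rewrite exchange_big /=; apply: eq_bigr => k _.
    rewrite /c addn1 exprS -[X * _]/(X *m _) mxE mulr_sumr mulr_suml.
    by apply: eq_bigr => l _; rewrite expr_scalemx mxE; ring.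
  by apply: cvg_fin_sum => l; apply: cvgMl_tmp; apply: cvg_expmx_entry.
rewrite e1 (_ : (fun s => _) = fun s => limn (pseries (c 0) s)); last first.
  by apply/funext => s; rewrite e.
rewrite -dc; apply: (@pseries_snd_diffs _ _ (`|t| + 1)); rewrite ?dc ?dc.
- exact: cvg_exp_entries.
- exact: cvg_exp_entries.
- exact: cvg_exp_entries.
- by rewrite [ltRHS]ger0_norm ?addr_ge0 // ltrDl.
Qed.

Lemma mxderive_expmxN X t :
  mxderive (fun s => expmx ((- s) *: X)) t (- (X *m expmx ((- t) *: X))).
Proof.
have := @mxderive_affine _ _ _ (fun s => expmx (s *: X)) (-1) 0 t _
  (mxderive_expmx X _).
rewrite scaleN1r mulN1r addr0.
rewrite (_ : (fun s => expmx ((-1 * s + 0) *: X)) = fun s => expmx ((- s) *: X)) //.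
by apply/funext => s; rewrite mulN1r addr0.
Qed.

Lemma expmx0 : expmx (0 : 'M[R]_n) = 1%:M.
Proof.
apply/matrixP => i j; have /cvg_lim <- // := @cvg_expmx_entry (0 : 'M[R]_n) i j.
apply: cvg_lim => //; rewrite -cvg_shiftS /=.
rewrite (_ : (fun _ => _) = cst ((1%:M : 'M[R]_n) i j)); first exact: cvg_cst.
apply/funext => N; rewrite /series /= big_nat_recl //= fact0 invr1 mul1r expr0.
by rewrite big1 ?addr0 // => k _; rewrite exprS mul0r mxE mulr0.
Qed.

(** The product exp((x + c)X) exp(-xX) has zero derivative in x. *)
Lemma expmxD X s t : expmx (s *: X) *m expmx (t *: X) = expmx ((s + t) *: X).
Proof.
have com u : X *m expmx (u *: X) = expmx (u *: X) *m X.
  by apply: expmx_comm; rewrite -scalemxAr scalemxAl.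
have D1 c x : mxderive (fun x => expmx ((x + c) *: X)) x (X *m expmx ((x + c) *: X)).
  have := @mxderive_affine _ _ _ (fun x => expmx (x *: X)) 1 c x _ (mxderive_expmx X _).
  by rewrite scale1r mul1r (_ : (fun s => expmx ((1 * s + c) *: X)) = fun x => expmx ((x + c) *: X)) //;
    apply/funext => y; rewrite mul1r.
have D2 := mxderive_expmxN X.
have cst c x : expmx ((x + c) *: X) *m expmx ((- x) *: X) = expmx (c *: X).
  rewrite (@mxderive_const _ _ _ (fun x => expmx ((x + c) *: X) *m expmx ((- x) *: X)) x 0).
    by rewrite add0r oppr0 scale0r expmx0 mulmx1.
  move=> y; have := mxderiveM (D1 c y) (D2 y).
  by rewrite mulmxN !mulmxA com subrr.
have inv u : expmx ((- u) *: X) *m expmx (u *: X) = 1%:M.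
  have := cst 0 (- u); by rewrite addr0 opprK scale0r expmx0.
have /(congr1 (mulmx^~ (expmx (t *: X)))) := cst s t.
by rewrite -mulmxA (inv t) mulmx1 (addrC t s) => ->.
Qed.

Lemma expmxN X t : expmx ((- t) *: X) *m expmx (t *: X) = 1%:M.
Proof. by rewrite expmxD addNr scale0r expmx0. Qed.

Lemma expmx_inv X t : invmx (expmx (t *: X)) = expmx ((- t) *: X).
Proof.
have e := expmxN X t; have [_ u] := mulmx1_unit e.
by rewrite -[RHS](mulmxK u) e mul1mx.
Qed.

Lemma expmx_conj A B X : A *m B = 1%:M -> A *m expmx X *m B = expmx (A *m X *m B).
Proof.
move=> AB; have BA := mulmx1C AB.
pose f (M : 'M[R]_n) := A *m M *m B.
have flin : linear f.
  by move=> c M N; rewrite /f mulmxDr mulmxDl -scalemxAr -scalemxAl.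
pose fmix := GRing.isLinear.Build R _ _ _ f flin.
pose fL : {linear 'M[R]_n -> 'M[R]_n} := HB.pack f fmix.
apply: (@expmx_image fL) => /=; elim=> [|k IH]; rewrite /f.
  by rewrite !expr0 mulmx1.
by rewrite !exprS -IH /f -![_ * _]/(_ *m _) !mulmxA -(mulmxA _ B A) BA mulmx1.
Qed.

Lemma expmx_tr X : (expmx X)^T = expmx X^T.
Proof.
apply: (@expmx_image (@trmx R n n)) => k; elim: k => [|k IH].
  by rewrite !expr0; apply: trmx1.
by rewrite exprSr exprS -IH; apply: trmx_mul.
Qed.

Lemma expmx_scale_functional (T : {scalar 'M[R]_n}) X t :
  (forall k, T (X ^+ k) = 0) -> T (expmx (t *: X)) = 0.
Proof.
move=> T0; apply: expmx_functional_eq0 => k.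
by rewrite expr_scalemx scalarZ T0 mulr0.
Qed.

Lemma mxderive_expmx0 X : mxderive (fun s => expmx (s *: X)) 0 X.
Proof.
have := @mxderive_expmx X 0.
by rewrite scale0r expmx0 mulmx1.
Qed.

Lemma expmx_first_order X e : 0 < e -> exists2 d, 0 < d & forall h : R,
  `|h| < d -> mxnorm1 (expmx (h *: X) - 1%:M - h *: X) <= e * `|h|.
Proof.
move=> e0.
have lim : \sum_i \sum_j `|h^-1 * (expmx (h *: X) i j - (1%:M : 'M[R]_n) i j) - X i j|
    @[h --> (0:R)^'] --> \sum_(i < n) \sum_(j < n) (0 : R).
  apply: cvg_fin_sum => i; apply: cvg_fin_sum => j.
  have [der dval] := mxderive_expmx0 X i j.
  have := der; rewrite /derivable => /cvg_ex[l lP].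
  have lX : l = X i j by rewrite -dval /derive; apply/esym/cvg_lim.
  rewrite lX in lP.
  rewrite (_ : (fun h : R => _) = fun h : R => `|h^-1 *:
      (((fun s => expmx (s *: X) i j) \o shift 0) (h *: (1 : R)) -
        expmx (0 *: X) i j) - X i j|); last first.
    by apply/funext => h; rewrite /= [h *: 1]mulr1 addr0 scale0r expmx0.
  have z : `|X i j - X i j| = 0 by rewrite subrr normr0.
  rewrite -[X in _ --> X]z.
  by apply: cvg_norm; apply: cvgB; [exact: lP | exact: cvg_cst].
move/cvgrPdist_lt: lim => /(_ _ e0); rewrite near_withinE => /nbhs_ballP[d d0 dP].
exists d => // h hd.
have [->|h0] := eqVneq h 0.
  by rewrite !scale0r expmx0 subrr subr0 mxnorm1_0 normr0 mulr0.
have := dP h; rewrite /= /ball /= sub0r normrN => /(_ hd h0).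
rewrite big1 => [|i _]; last by rewrite big1.
rewrite sub0r normrN ger0_norm; last first.
  by apply: sumr_ge0 => i _; apply: sumr_ge0.
move=> lt; have h0' : `|h| != 0 by rewrite normr_eq0.
rewrite mulrC -ler_pdivrMl ?normr_gt0 //.
apply: le_trans (ltW lt); rewrite /mxnorm1 mulr_sumr; apply: ler_sum => i _.
rewrite mulr_sumr; apply: ler_sum => j _.
rewrite -normfV -normrM; move: (expmx (h *: X)) => E.
rewrite [(E - _ - _) i j]mxE [(E - _) i j]mxE [(- 1%:M) i j]mxE [(- (h *: X)) i j]mxE.
rewrite [(h *: X) i j]mxE.
move: ((1%:M : 'M[R]_n) i j) (E i j) (X i j) => a b c.
have -> : h^-1 * (b - a - h * c) = h^-1 * (b - a) - c by field.
by [].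
Qed.

End MatrixExponential.

(** * Subspaces stable under one-parameter groups *)
Section Separation.
Variables (R : realType) (n : nat).
Implicit Types (M N X : 'M[R]_n).

Lemma complexify_mxDZ m p c (A B : 'M[R]_(m, p)) :
  complexify_mx (c *: A + B) =
  real_complex R c *: complexify_mx A + complexify_mx B.
Proof. by rewrite /complexify_mx map_mxD map_mxZ. Qed.

Lemma complexify_mxM m p q (A : 'M[R]_(m, p)) (B : 'M[R]_(p, q)) :
  complexify_mx (A *m B) = complexify_mx A *m complexify_mx B.
Proof. exact: map_mxM. Qed.

Lemma Re_realD c (z w : R[i]) :
  complex.Re (real_complex R c * z + w) = c * complex.Re z + complex.Re w.
Proof. by case: z w => [a b] [a' b'] /=; rewrite mul0r subr0. Qed.

Lemma Im_realD c (z w : R[i]) :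
  complex.Im (real_complex R c * z + w) = c * complex.Im z + complex.Im w.
Proof. by case: z w => [a b] [a' b'] /=; rewrite mul0r addr0. Qed.

(** Real linear forms on real matrices decide whether a matrix sends [v] into a
    complex subspace.  They carry limits and derivatives of real matrices over
    to complex subspaces. *)
Lemma separate_complex_subspace (P : {vspace 'cV[R[i]]_n}) (v : 'cV[R[i]]_n) M :
  complexify_mx M *m v \notin P ->
  exists T : {scalar 'M[R]_n}, T M != 0 /\
    forall N, complexify_mx N *m v \in P -> T N = 0.
Proof.
move=> MP.
pose r N : 'cV[R[i]]_n := complexify_mx N *m v - projv P (complexify_mx N *m v).
have rlin c A B : r (c *: A + B) = real_complex R c *: r A + r B.
  rewrite /r complexify_mxDZ mulmxDl -scalemxAl.
  move: (complexify_mx A *m v) (complexify_mx B *m v) => a b.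
  by rewrite linearD linearZ /=; vector_ring.
have r0 N : complexify_mx N *m v \in P -> r N = 0.
  by move=> NP; rewrite /r projv_id // subrr.
have : r M != 0.
  apply: contra MP; rewrite subr_eq0 => /eqP ->; exact: memv_proj.
move=> /eqP rM; have [i rMi] : exists i, r M i 0 != 0.
  apply/not_existsP => H; apply: rM; apply/matrixP => i j.
  by rewrite ord1 [RHS]mxE; apply/eqP/negPn/negP/H.
have [|T1 T1E] := exists_scalar (f := fun N => complex.Re (r N i 0)).
  by move=> c A B; rewrite rlin; move: (r A) (r B) => u w; rewrite !mxE Re_realD.
have [|T2 T2E] := exists_scalar (f := fun N => complex.Im (r N i 0)).
  by move=> c A B; rewrite rlin; move: (r A) (r B) => u w; rewrite !mxE Im_realD.
have [e|T1M] := eqVneq (T1 M) 0; last first.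
  by exists T1; split=> // N /r0 e; rewrite T1E e mxE.
exists T2; split=> [|N /r0 e']; last by rewrite T2E e' mxE.
apply: contra rMi; rewrite T1E in e; rewrite T2E => /eqP e'.
by move: e e'; case: (r M i 0) => a b /= -> ->.
Qed.

Lemma separate_subspace (q : {vspace 'M[R]_n}) M : M \notin q ->
  exists T : {scalar 'M[R]_n}, T M != 0 /\ forall N, N \in q -> T N = 0.
Proof.
move=> Mq; pose r N := N - projv q N.
have r0 N : N \in q -> r N = 0 by move=> Nq; rewrite /r projv_id // subrr.
have /eqP rM : r M != 0.
  by apply: contra Mq; rewrite subr_eq0 => /eqP ->; exact: memv_proj.
have [i [j rMij]] : exists i j, r M i j != 0.
  apply/not_existsP => H; apply: rM; apply/matrixP => i j; rewrite [RHS]mxE.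
  by apply/eqP/negPn/negP => rij; apply: (H i); exists j.
have [|T TE] := exists_scalar (f := fun N => r N i j).
  by move=> c A B; rewrite /r linearP !mxE; ring.
by exists T; split=> [|N /r0 e]; rewrite TE // e mxE.
Qed.

Lemma expmx_stable (P : {vspace 'cV[R[i]]_n}) X :
  (forall v, v \in P -> complexify_mx X *m v \in P) ->
  forall t v, v \in P -> complexify_mx (expmx (t *: X)) *m v \in P.
Proof.
move=> XP t v vP; apply/negPn/negP => /separate_complex_subspace[T [TM T0]].
case/eqP: TM; apply: expmx_scale_functional => k; apply: T0.
elim: k => [|k IH].
  have -> : complexify_mx (X ^+ 0) = 1%:M by apply: map_mx1.
  by rewrite mul1mx.
by rewrite exprS -[_ * _]/(_ *m _) complexify_mxM -mulmxA XP.
Qed.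

Lemma expmx_stable_generator (P : {vspace 'cV[R[i]]_n}) X :
  (forall t v, v \in P -> complexify_mx (expmx (t *: X)) *m v \in P) ->
  forall v, v \in P -> complexify_mx X *m v \in P.
Proof.
move=> eP v vP; apply/negPn/negP => /separate_complex_subspace[T [TM T0]].
case/eqP: TM; apply: mxderive_functional_eq0 (mxderive_expmx0 X) _ => s.
by apply/T0/eP.
Qed.

(** The curve Z(t) = exp(t ad X) Y, the exponential being that of the matrix of
    ad X on the space of matrices, stays in [q]; and exp(-tX) Z(t) exp(tX) has
    zero derivative, so Z(t) = exp(tX) Y exp(-tX). *)
Lemma expmx_ad_stable (q : {vspace 'M[R]_n}) X :
  (forall Y, Y \in q -> lie_bracket X Y \in q) ->
  forall t Y, Y \in q -> expmx (t *: X) *m Y *m expmx ((- t) *: X) \in q.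
Proof.
move=> Xq t Y Yq.
pose M := lin_mx (lie_bracket X).
pose Z s : 'M[R]_n := vec_mx (mxvec Y *m expmx (s *: M)).
have Zq s : Z s \in q.
  apply/negPn/negP => /separate_subspace[T [TM T0]].
  have [|T' T'E] := exists_scalar (f := fun W : 'M[R]_(n * n) => T (vec_mx (mxvec Y *m W))).
    by move=> c A B; rewrite mulmxDr -scalemxAr !linearP.
  case/eqP: TM; rewrite -T'E; apply: expmx_scale_functional => k; rewrite T'E.
  apply: T0; elim: k => [|k IH]; first by rewrite expr0 mulmx1 mxvecK.
  rewrite exprSr -[_ * M]/(_ *m M) mulmxA -[_ *m M ^+ k]vec_mxK mul_vec_lin mxvecK.
  exact: Xq.
have Zd s : mxderive Z s (lie_bracket X (Z s)).
  move=> i j.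
  have [|T TE] := exists_scalar (f := fun W : 'M[R]_(n * n) => vec_mx (mxvec Y *m W) i j : R).
    by move=> c A B; rewrite mulmxDr -scalemxAr linearP /= !mxE.
  have := mxderive_functional T (@mxderive_expmx _ _ M s).
  rewrite (_ : (fun x => T _) = fun x => Z x i j); last by apply/funext => x; rewrite TE.
  rewrite TE (expmx_comm (A := M)); last by rewrite -scalemxAl scalemxAr.
  by rewrite mulmxA -[mxvec Y *m expmx _]vec_mxK mul_vec_lin mxvecK.
have com u : X *m expmx (u *: X) = expmx (u *: X) *m X.
  by apply: expmx_comm; rewrite -scalemxAr scalemxAl.
have D2 := mxderive_expmxN X.
pose W s := expmx ((- s) *: X) *m Z s *m expmx (s *: X).
have WY : W t = Y.
  have -> : W t = W 0.
    apply: mxderive_const => x.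
    have := mxderiveM (mxderiveM (D2 x) (Zd x)) (mxderive_expmx X x).
    suff -> : (- (X *m expmx (- x *: X)) *m Z x + expmx (- x *: X) *m lie_bracket X (Z x))
       *m expmx (x *: X) + expmx (- x *: X) *m Z x *m (X *m expmx (x *: X)) = 0 by [].
    rewrite /lie_bracket (com (- x)).
    rewrite mulmxBr mulNmx !mulmxA addKr.
    by rewrite mulNmx addNr.
  by rewrite /W /Z oppr0 !scale0r !expmx0 !mulmx1 mul1mx mxvecK.
have EN := expmxN X t; have NE := mulmx1C EN.
by rewrite -WY /W !mulmxA NE mul1mx -mulmxA NE mulmx1 Zq.
Qed.

End Separation.

Section LieAlgebraOfGroup.
Variables (R : realType) (n : nat).
Variables (G : set 'M[R]_n) (g : {vspace 'M[R]_n}).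
Hypothesis G_closed_subgroup : closed_subgroup_SL G.
Hypothesis g_lie : is_lie_algebra_of G g.

Let GM A B : G A -> G B -> G (A *m B).
Proof. by case: G_closed_subgroup => _ _ h _ _; apply: h. Qed.

(** The bracket is the derivative at 0 of exp(sX) Y exp(-sX), a curve in [g]
    since [G] is stable under conjugation. *)
Lemma lie_algebra_bracket : (lie_bracketv g g <= g)%VS.
Proof.
apply/lie_bracketv_subP => X Y Xg Yg.
have Ad s : expmx (s *: X) *m Y *m expmx ((- s) *: X) \in g.
  apply/g_lie => t.
  have e : expmx (s *: X) *m expmx ((- s) *: X) = 1%:M by apply/mulmx1C/expmxN.
  have -> : t *: (expmx (s *: X) *m Y *m expmx ((- s) *: X)) =
     expmx (s *: X) *m (t *: Y) *m expmx ((- s) *: X).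
    by rewrite -scalemxAr -scalemxAl.
  rewrite -expmx_conj //.
  have /g_lie GX := Xg; have /g_lie GY := Yg.
  by do 2?apply: GM.
apply/negPn/negP => /separate_subspace[T [TM T0]]; case/eqP: TM.
have D2 := mxderive_expmxN X.
have := mxderiveM (mxderiveM (mxderive_expmx0 X) (mxderive_cst Y 0)) (D2 0).
rewrite oppr0 !scale0r !expmx0 !mulmx1 mulmx0 addr0 mul1mx mulmxN.
by move=> FD; apply: mxderive_functional_eq0 FD _ => s; apply/T0/Ad.
Qed.

(** Transposition maps k exp(P) to exp(P) k^-1, so it preserves G = K exp(p). *)
Lemma lie_algebra_tr : compatible_decomposition G g ->
  forall X, X \in g -> X^T \in g.
Proof.
move=> dec X Xg.
have GT A : G A -> G A^T.
  move=> GA; have := GA; rewrite {1}dec => -[k [P [[Gk [kk dk]] [Pg [Ps _]] ->]]].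
  rewrite trmx_mul expmx_tr Ps.
  have -> : k^T = invmx k.
    have [_ uk] := mulmx1_unit kk.
    by rewrite -[LHS](mulmxK uk) kk mul1mx.
  apply: GM; last by case: G_closed_subgroup => _ _ _ h _; apply: h.
  by have /g_lie/(_ 1) := Pg; rewrite scale1r.
apply/g_lie => t; have -> : t *: X^T = (t *: X)^T by rewrite linearZ.
by rewrite -expmx_tr; apply: GT; move/g_lie: Xg.
Qed.

Lemma expmx_normalizes (q : {vspace 'M[R]_n}) X : lie_subalgebra g q ->
  X \in q -> forall t, normalizer_in G q (expmx (t *: X)).
Proof.
move=> [/subvP qg /lie_bracketv_subP qq] Xq t; split.
  by have /qg/g_lie := Xq.
have st := expmx_ad_stable (fun Y => qq X Y Xq).
move=> Y; rewrite expmx_inv; apply/idP/idP => [H|]; last exact: st.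
have EN := expmxN X t.
have := st (- t) _ H; rewrite opprK !mulmxA EN mul1mx -mulmxA EN.
by rewrite mulmx1.
Qed.

End LieAlgebraOfGroup.

(** * Neighbourhoods of the identity in a closed matrix group *)
Section EulerMethod.
Variables (R : realType) (n : nat).
Implicit Types (A B T X Y : 'M[R]_n).

Lemma mxnorm1_mul_near1 A X e : mxnorm1 (A - 1%:M) <= e ->
  mxnorm1 (A *m X) <= (1 + e) * mxnorm1 X.
Proof.
move=> Ae; rewrite -[A *m X](subrK X) mulrDl mul1r addrC.
apply: le_trans (ler_mxnorm1D _ _) _; rewrite lerD2l.
have -> : A *m X - X = (A - 1%:M) *m X by rewrite mulmxBl mul1mx.
apply: le_trans (ler_mxnorm1M _ _) _; apply: ler_wpM2r => //; exact: mxnorm1_ge0.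
Qed.

Lemma mxnorm1_pow_near1 A e m : 0 <= e -> mxnorm1 (A - 1%:M) <= e ->
  mxnorm1 (A ^+ m) <= mxnorm1 (1%:M : 'M[R]_n) * (1 + e) ^+ m.
Proof.
move=> e0 Ae; elim: m => [|m IH]; first by rewrite !expr0 mulr1.
rewrite !exprS -[_ * A ^+ m]/(_ *m _); apply: le_trans (mxnorm1_mul_near1 _ Ae) _.
by rewrite mulrCA ler_wpM2l // addr_ge0.
Qed.

Lemma mxnorm1_pow_sub A B e m : 0 <= e ->
  mxnorm1 (A - 1%:M) <= e -> mxnorm1 (B - 1%:M) <= e ->
  mxnorm1 (A ^+ m - B ^+ m) <=
  m%:R * mxnorm1 (A - B) * (mxnorm1 (1%:M : 'M[R]_n) * (1 + e) ^+ m).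
Proof.
move=> e0 Ae Be; elim: m => [|m IH].
  by rewrite !expr0 subrr mxnorm1_0 mul0r mul0r.
have -> : A ^+ m.+1 - B ^+ m.+1 = A *m (A ^+ m - B ^+ m) + (A - B) *m B ^+ m.
  by rewrite !exprS mulmxBr mulmxBl addrA subrK.
apply: le_trans (ler_mxnorm1D _ _) _.
apply: le_trans (lerD (mxnorm1_mul_near1 _ Ae) (ler_mxnorm1M _ _)) _.
have D0 := mxnorm1_ge0 (A - B).
have N0 := mxnorm1_ge0 (1%:M : 'M[R]_n).
have p1 : 0 <= (1 + e) ^+ m by rewrite exprn_ge0 // addr_ge0.
apply: le_trans (lerD (ler_wpM2l _ IH) (ler_wpM2l D0 (mxnorm1_pow_near1 m e0 Be))) _.
  by rewrite addr_ge0.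
rewrite -subr_ge0 exprS -natr1.
set D := mxnorm1 (A - B) in D0 *; set N := mxnorm1 _ in N0 *; set p := (1 + e) ^+ m in p1 *.
have -> : (m%:R + 1) * D * (N * ((1 + e) * p)) - ((1 + e) * (m%:R * D * (N * p)) + D * (N * p))
   = e * (D * N * p) by ring.
by rewrite !mulr_ge0.
Qed.

Lemma expmx_pow X h m : expmx (h *: X) ^+ m = expmx ((m%:R * h) *: X).
Proof.
elim: m => [|m IH]; first by rewrite expr0 mul0r scale0r expmx0.
rewrite exprS IH -[_ * expmx _]/(_ *m _) expmxD; congr (expmx (_ *: X)).
by rewrite -natr1; ring.
Qed.

Lemma ler_pow_exp (e : R) m : 0 <= e -> (1 + e) ^+ m <= expR (m%:R * e).
Proof.
move=> e0; rewrite mulrC expRM_natr; apply: lerXn2r.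
- by rewrite nnegrE addr_ge0.
- by rewrite nnegrE expR_ge0.
- exact: expR_ge1Dx.
Qed.

(** As in Euler's method, exp(tY) is the limit of (1 + e Y')^m as e tends to 0,
    Y' tends to Y and m is the integer part of t/e: each factor differs from
    exp(eY) by o(e), and m of them make an error m o(e), which tends to 0. *)
Lemma one_parameter_limit (G : set 'M[R]_n) Y :
  G 1%:M -> (forall A B, G A -> G B -> G (A *m B)) ->
  (forall A, ~ G A -> exists2 d, 0 < d & forall B, mxnorm1 (B - A) < d -> ~ G B) ->
  (forall eta, 0 < eta -> exists e Y',
     [/\ 0 < e, e < eta, mxnorm1 (Y' - Y) < eta & G (1%:M + e *: Y')]) ->
  forall t, 0 <= t -> G (expmx (t *: Y)).
Proof.
move=> G1 GM Gcl appr t t0; apply: contrapT => /Gcl[d d0 dP].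
(* Both 1 + e Y' and exp(eY) are within e c of 1, so their m-th powers are
   bounded by K; M eta bounds the total error. *)
pose c := mxnorm1 Y + 2.
have Y0 := mxnorm1_ge0 Y.
have c0 : 0 < c by rewrite ltr_wpDl.
pose K := mxnorm1 (1%:M : 'M[R]_n) * expR (t * c).
have K0 : 0 <= K by rewrite mulr_ge0 ?mxnorm1_ge0 ?expR_ge0.
pose M := K * (2 * t + c).
have M0 : 0 <= M by rewrite mulr_ge0 // addr_ge0 ?mulr_ge0 // ltW.
pose eta := Num.min 1 (d / (M + 1)).
have eta0 : 0 < eta by rewrite lt_min ltr01 divr_gt0 // ltr_wpDl.
have eta1 : eta <= 1 by rewrite ge_min lexx.
have Meta : M * eta < d.
  apply: le_lt_trans (_ : M * (d / (M + 1)) < d).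
    by rewrite ler_wpM2l // ge_min lexx orbT.
  by rewrite mulrA ltr_pdivrMr ?ltr_wpDl // mulrDr mulr1 mulrC ltrDl.
clearbody eta.
have [r r0 rP] := expmx_first_order Y eta0.
have [|e [Y' [e0 e_lt YY' GB]]] := appr (Num.min r eta); first by rewrite lt_min r0.
move: e_lt YY'; rewrite !lt_min => /andP[er eeta] /andP[_ YY'].
pose B := 1%:M + e *: Y'; pose T := expmx (e *: Y).
have nB : mxnorm1 (B - 1%:M) <= e * c.
  rewrite /B addrC addKr mxnorm1Z gtr0_norm // ler_wpM2l ?(ltW e0) //.
  rewrite -[Y'](subrK Y); apply: le_trans (ler_mxnorm1D _ _) _.
  rewrite /c addrC lerD2l (le_trans (ltW YY')) // (le_trans eta1) //.
  by rewrite ler1n.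
have nT h : 0 <= h -> h <= e -> mxnorm1 (expmx (h *: Y) - 1%:M) <= h * c.
  move=> h0 he; rewrite -[_ - _](subrK (h *: Y)).
  apply: le_trans (ler_mxnorm1D _ _) _.
  have := rP h; rewrite ger0_norm // => /(_ (le_lt_trans he er)) H.
  apply: le_trans (lerD H (lexx _)) _.
  rewrite mxnorm1Z ger0_norm // mulrC -mulrDr ler_wpM2l // addrC lerD2l.
  by rewrite (le_trans eta1) // ler1n.
have nBT : mxnorm1 (B - T) <= 2 * eta * e.
  have -> : B - T = e *: (Y' - Y) - (T - 1%:M - e *: Y).
    by rewrite /B scalerBr; vector_ring.
  apply: le_trans (ler_mxnorm1D _ _) _; rewrite mxnorm1N mxnorm1Z gtr0_norm //.
  have := rP e; rewrite gtr0_norm // => /(_ er) H.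
  rewrite mulr2n mulrDl mul1r mulrDl lerD // mulrC ler_wpM2r //; exact: ltW.
pose m := Num.truncn (t / e).
have te0 : 0 <= t / e by rewrite divr_ge0 // ltW.
have /andP[m1 m2] := truncn_itv te0.
have me : m%:R * e <= t by rewrite -ler_pdivlMr.
have me2 : t - m%:R * e <= e.
  have : t <= m.+1%:R * e by rewrite -ler_pdivrMr // ltW.
  by rewrite -natr1 mulrDl mul1r lerBlDl.
have mece : expR (m%:R * (e * c)) <= expR (t * c).
  by rewrite ler_expR mulrA ler_wpM2r // ltW.
have ec0 : 0 <= e * c by rewrite mulr_ge0 // ltW.
have GBm : G (B ^+ m).
  by elim: (m) => [|k IH]; [rewrite expr0 | rewrite exprS; apply: GM].
apply: (dP (B ^+ m)) GBm; apply: le_lt_trans Meta.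
have -> : B ^+ m - expmx (t *: Y) = (B ^+ m - T ^+ m) + (T ^+ m - expmx (t *: Y)).
  by rewrite addrA subrK.
apply: le_trans (ler_mxnorm1D _ _) _.
have powK : mxnorm1 (1%:M : 'M[R]_n) * (1 + e * c) ^+ m <= K.
  rewrite /K ler_wpM2l ?mxnorm1_ge0 //; apply: le_trans (ler_pow_exp _ ec0) mece.
have le1 : mxnorm1 (B ^+ m - T ^+ m) <= 2 * t * eta * K.
  apply: le_trans (mxnorm1_pow_sub m ec0 nB (nT e (ltW e0) (lexx e))) _.
  apply: ler_pM => //.
  - by rewrite mulr_ge0 ?mxnorm1_ge0.
  - by rewrite mulr_ge0 ?mxnorm1_ge0 // exprn_ge0 // addr_ge0.
  apply: le_trans (ler_wpM2l _ nBT) _; first exact: ler0n.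
  have -> : m%:R * (2 * eta * e) = (2 * eta) * (m%:R * e) by ring.
  have -> : 2 * t * eta = (2 * eta) * t by ring.
  by rewrite ler_wpM2l // mulr_ge0 // ltW.
have le2 : mxnorm1 (T ^+ m - expmx (t *: Y)) <= K * (eta * c).
  have -> : T ^+ m - expmx (t *: Y) = T ^+ m *m (1%:M - expmx ((t - m%:R * e) *: Y)).
    by rewrite mulmxBr mulmx1 /T expmx_pow expmxD [m%:R * e + _]addrC subrK.
  apply: le_trans (ler_mxnorm1M _ _) _; apply: ler_pM; rewrite ?mxnorm1_ge0 //.
    by apply: le_trans (mxnorm1_pow_near1 m ec0 (nT e (ltW e0) (lexx e))) powK.
  rewrite mxnorm1_distC; apply: le_trans (nT _ _ me2) _; first by rewrite subr_ge0.
  rewrite ler_wpM2r ?(ltW c0) //; apply: le_trans me2 (ltW eeta).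
apply: le_trans (lerD le1 le2) _.
by rewrite /M le_eqVlt; apply/orP; left; apply/eqP; ring.
Qed.

End EulerMethod.

Section ClosedSubgroup.
Variables (R : realType) (n : nat).
Implicit Types (A B X Y h : 'M[R]_n).

Lemma open_mxnorm1P (U : set 'M[R]_n) : open U <->
  forall A, U A -> exists2 d, 0 < d & forall B, mxnorm1 (B - A) < d -> U B.
Proof.
split=> [oU A UA|H].
  have /nbhs_ballP[e /= e0 eU] : nbhs A U by apply: open_nbhs_nbhs.
  exists e => // B BA; apply: eU; split=> // i j; rewrite /ball /=.
  apply: le_lt_trans BA; rewrite distrC.
  by have := ler_mxnorm1_entry (B - A) i j; rewrite !mxE.
rewrite openE => A /H[d d0 dU]; rewrite /interior; apply/nbhs_ballP.
exists (d / (n * n).+1%:R) => /=; first by rewrite divr_gt0.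
move=> B AB; apply/dU/mxnorm1_lt => // i j; rewrite !mxE distrC.
by have := AB.2 i j; rewrite /ball /= => /ltW.
Qed.

(** Compactness of the unit cube, transported from row vectors. *)
Lemma mxnorm1_cluster (Y : nat -> 'M[R]_n) : (forall k, mxnorm1 (Y k) <= 1) ->
  exists Z, forall eta, 0 < eta -> forall N, exists2 k, (N <= k)%N & mxnorm1 (Y k - Z) < eta.
Proof.
move=> Y1.
have cpt : compact [set v : 'rV[R]_(n * n) | forall i, `[(-1 : R), 1]%classic (v ord0 i)].
  by apply: (@rV_compact R (n * n) (fun=> `[-1, 1]%classic)) => i; apply: segment_compact.
have [|v [_ vcl]] := cpt ((fun k => mxvec (Y k)) @ \oo) _ _.
  exists 0 => // k _ i /=; rewrite in_itv /= -ler_norml.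
  case/mxvec_indexP: i => i j; rewrite mxvecE.
  exact: le_trans (ler_mxnorm1_entry _ _ _) (Y1 k).
exists (vec_mx v) => eta eta0 N.
have [|| u [[k Nk <-] uv]] :=
    vcl [set mxvec (Y k) | k in [set k | (N <= k)%N]]
      (ball v (eta / (n * n).+1%:R)).
- by exists N => // k Nk; exists k.
- by apply: nbhsx_ballx; rewrite divr_gt0.
exists k => //; apply: mxnorm1_lt => // i j; rewrite !mxE distrC.
by have := uv.2 ord0 (mxvec_index i j); rewrite /ball /= mxvecE => /ltW.
Qed.

Variables (G H : set 'M[R]_n) (g : {vspace 'M[R]_n}).
Hypothesis G_closed_subgroup : closed_subgroup_SL G.
Hypothesis g_lie : is_lie_algebra_of G g.
Hypothesis HG : H `<=` G.
Hypothesis H1 : H 1%:M.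
Hypothesis HM : forall A B, H A -> H B -> H (A *m B).
Hypothesis HV : forall A, H A -> H (invmx A).
Hypothesis H_closed : forall A, G A -> ~ H A ->
  exists2 d, 0 < d & forall B, mxnorm1 (B - A) < d -> ~ H B.
Hypothesis H_exp : forall X, X \in g -> H (expmx X).

Lemma closed_subgroup_unit A : G A -> A \in unitmx.
Proof. by case: G_closed_subgroup => det1 _ _ _ _ /det1; rewrite unitmxE => ->; apply: unitr1. Qed.

Let GM A B : G A -> G B -> G (A *m B).
Proof. by case: G_closed_subgroup => _ _ h _ _; apply: h. Qed.

Let GV A : G A -> G (invmx A).
Proof. by case: G_closed_subgroup => _ _ _ h _; apply: h. Qed.

Let G1 : G 1%:M.
Proof. by case: G_closed_subgroup. Qed.

(** Up to a factor 2, B realizes the distance from 1 to the coset AH.  This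
    distance is positive because [H] is closed and does not contain the inverse
    of [A]. *)
Lemma nearly_closest_in_coset A : G A -> ~ H A -> exists B,
  [/\ G B, 0 < mxnorm1 (B - 1%:M), mxnorm1 (B - 1%:M) <= 2 * mxnorm1 (A - 1%:M)
    & forall h, H h -> mxnorm1 (B - 1%:M) <= 2 * mxnorm1 (B *m h - 1%:M)].
Proof.
move=> GA nHA; have uA := closed_subgroup_unit GA.
pose S := [set mxnorm1 (A *m h - 1%:M) | h in H].
have S0 : S !=set0 by exists (mxnorm1 (A *m 1%:M - 1%:M)); exists 1%:M.
have lS : lbound S 0 by move=> _ [h _ <-]; apply: mxnorm1_ge0.
have hS : has_inf S by split=> //; exists 0.
have infle h : H h -> inf S <= mxnorm1 (A *m h - 1%:M).
  by move=> Hh; apply: ge_inf; [exists 0 | exists h].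
have inf0 : 0 < inf S.
  have nHV : ~ H (invmx A) by move=> /HV; rewrite invmxK.
  have [d d0 dP] := H_closed (GV GA) nHV.
  pose c := 1 + mxnorm1 (invmx A).
  have c0 : 0 < c by rewrite ltr_wpDr ?mxnorm1_ge0.
  apply: lt_le_trans (_ : d / c <= _); first by rewrite divr_gt0.
  apply: lb_le_inf => // _ [h Hh <-]; rewrite leNgt; apply/negP => lt.
  apply: (dP h) Hh; rewrite ltr_pdivlMr // in lt.
  apply: le_lt_trans lt.
  have -> : h - invmx A = invmx A *m (A *m h - 1%:M).
    by rewrite mulmxBr mulmx1 mulKmx.
  apply: le_trans (ler_mxnorm1M _ _) _; rewrite mulrC ler_wpM2l ?mxnorm1_ge0 //.
  by rewrite /c lerDr.
have [_ [h Hh <-] lt] := inf_adherent inf0 hS.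
have lt2 : mxnorm1 (A *m h - 1%:M) <= 2 * inf S by rewrite mulr2n mulrDl mul1r ltW.
exists (A *m h); split.
- by apply: GM => //; apply: HG.
- exact: lt_le_trans inf0 (infle h Hh).
- apply: le_trans lt2 _; rewrite ler_wpM2l //.
  by have := infle _ H1; rewrite mulmx1.
- move=> h' Hh'; apply: le_trans lt2 _; rewrite ler_wpM2l // -mulmxA.
  exact/infle/HM.
Qed.

(** Otherwise [nearly_closest_in_coset] gives B_k in [G] with e_k = |B_k - 1|
    positive and tending to 0, such that multiplying B_k by an element of [H]
    cannot bring it closer to 1 than e_k / 2.  A cluster point Z of the
    (B_k - 1) / e_k lies in [g] by [one_parameter_limit], and then
    B_k exp(- e_k Z) - 1 = e_k (Y_k - Z) - e_k^2 Y_k Z + B_k o(e_k), with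
    Y_k = (B_k - 1) / e_k, is much smaller than e_k for suitable k. *)
Lemma subgroup_near_identity :
  exists2 d, 0 < d & forall A, G A -> mxnorm1 (A - 1%:M) < d -> H A.
Proof.
apply: contrapT => nex.
have seqB k : exists B, [/\ G B, 0 < mxnorm1 (B - 1%:M),
    mxnorm1 (B - 1%:M) < 2 * k.+1%:R^-1
    & forall h, H h -> mxnorm1 (B - 1%:M) <= 2 * mxnorm1 (B *m h - 1%:M)].
  have [A [GA A1 nHA]] : exists A, [/\ G A, mxnorm1 (A - 1%:M) < k.+1%:R^-1 & ~ H A].
    apply: contrapT => nA; apply: nex; exists k.+1%:R^-1; first by rewrite invr_gt0.
    by move=> A GA A1; apply: contrapT => nHA; apply: nA; exists A.
  have [B [GB B0 BA Bh]] := nearly_closest_in_coset GA nHA.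
  by exists B; split=> //; apply: le_lt_trans BA _; rewrite ltr_pM2l.
have /choice[B BP] := seqB.
pose e k := mxnorm1 (B k - 1%:M).
have e0 k : 0 < e k by case: (BP k).
pose Y k := (e k)^-1 *: (B k - 1%:M).
have BY k : B k = 1%:M + e k *: Y k.
  by rewrite /Y scalerA divff ?gt_eqF // scale1r addrC subrK.
have Y1 k : mxnorm1 (Y k) = 1.
  by rewrite mxnorm1Z gtr0_norm ?invr_gt0 // mulVf // gt_eqF.
have [|Z Zcl] := @mxnorm1_cluster Y; first by move=> k; rewrite Y1.
have appr eta : 0 < eta -> exists2 k, e k < eta & mxnorm1 (Y k - Z) < eta.
  move=> eta0; have [k kN kZ] := Zcl eta eta0 (Num.truncn (2 / eta)).
  exists k => //; have [_ _ lt _] := BP k; apply: lt_le_trans lt _.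
  rewrite ler_pdivrMr // mulrC -ler_pdivrMr //; apply: ltW.
  have te0 : 0 <= 2 / eta by rewrite divr_ge0 // ltW.
  have /andP[_ lt] := truncn_itv te0; apply: lt_le_trans lt _.
  by rewrite ler_nat ltnS.
have Gcl A : ~ G A -> exists2 d, 0 < d & forall B, mxnorm1 (B - A) < d -> ~ G B.
  case: G_closed_subgroup => _ _ _ _ Gc nGA.
  by have /open_mxnorm1P := closed_openC Gc; apply.
have appr' eta : 0 < eta -> exists e Y',
     [/\ 0 < e, e < eta, mxnorm1 (Y' - Z) < eta & G (1%:M + e *: Y')].
  move=> /appr[k ek kZ]; exists (e k), (Y k); split=> //.
  by rewrite -BY; case: (BP k).
have Gpos := one_parameter_limit G1 GM Gcl appr'.
have Zg : Z \in g.
  apply/g_lie => t; case: (leP 0 t) => t0; first exact: Gpos.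
  rewrite -[t]opprK -expmx_inv; apply/GV/Gpos; rewrite oppr_ge0; exact: ltW.
(* With 1/16 the three error terms add up to at most e_k / 4. *)
have c16 : 0 < 16^-1 :> R by rewrite invr_gt0.
have [r r0 rP] := expmx_first_order Z c16.
have eta0 : 0 < Num.min r (16^-1 / (1 + mxnorm1 Z)).
  by rewrite lt_min r0 divr_gt0 ?invr_gt0 // ltr_wpDr ?mxnorm1_ge0.
have [k] := appr _ eta0; rewrite !lt_min => /andP[er ez] /andP[_ kZ].
have Z0 := mxnorm1_ge0 Z.
have [_ _ _ /(_ (expmx ((- e k) *: Z)))] := BP k.
have HZ : H (expmx ((- e k) *: Z)) by apply: H_exp; rewrite memvZ.
move=> /(_ HZ); apply/negP; rewrite -ltNge -/(e k).
pose E := expmx ((- e k) *: Z) - 1%:M - (- e k) *: Z.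
have nE : mxnorm1 E <= 16^-1 * e k.
  by have := rP (- e k); rewrite normrN gtr0_norm //; apply.
have -> : B k *m expmx ((- e k) *: Z) - 1%:M =
    e k *: (Y k - Z) - e k ^+ 2 *: (Y k *m Z) + B k *m E.
  have -> : expmx ((- e k) *: Z) = E + 1%:M - e k *: Z.
    by rewrite /E scaleNr opprK; vector_ring.
  rewrite mulmxBr mulmxDr mulmx1 {2 3}BY mulmxDl mul1mx -!scalemxAl -!scalemxAr.
  by rewrite scalerA expr2; vector_ring.
have z16 : 16^-1 / (1 + mxnorm1 Z) <= 16^-1.
  by rewrite ler_pdivrMr ?ltr_wpDr // ler_peMr ?invr_ge0 // lerDl.
have n1 : mxnorm1 (e k *: (Y k - Z)) <= e k * 16^-1.
  by rewrite mxnorm1Z gtr0_norm // ler_wpM2l ?(ltW (e0 k)) // (le_trans (ltW kZ)).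
have n2 : mxnorm1 (e k ^+ 2 *: (Y k *m Z)) <= e k * 16^-1.
  rewrite mxnorm1Z ger0_norm ?exprn_ge0 ?(ltW (e0 k)) // expr2 -mulrA.
  rewrite ler_wpM2l ?(ltW (e0 k)) //.
  apply: le_trans (ler_wpM2l (ltW (e0 k)) (ler_mxnorm1M _ _)) _.
  rewrite Y1 mul1r; move: ez; rewrite ltr_pdivlMr ?ltr_wpDr // => /ltW; apply: le_trans.
  by rewrite ler_wpM2l ?(ltW (e0 k)) // lerDr.
have n3 : mxnorm1 (B k *m E) <= 2 * (16^-1 * e k).
  apply: le_trans (mxnorm1_mul_near1 E (lexx (e k))) _.
  apply: ler_pM => //; first by rewrite addr_ge0 // ltW.
    exact: mxnorm1_ge0.
  rewrite -[2]/(1 + 1) lerD2l (le_trans (ltW ez)) // (le_trans z16) //.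
  by rewrite invf_le1 // ler1n.
apply: le_lt_trans (_ : 2 * (e k * 16^-1 + e k * 16^-1 + 2 * (16^-1 * e k)) < _).
  rewrite ler_wpM2l //; apply: le_trans (ler_mxnorm1D _ _) _; apply: lerD n3.
  by apply: le_trans (ler_mxnorm1D _ _) _; rewrite mxnorm1N lerD.
by have := e0 k; lra.
Qed.

End ClosedSubgroup.

Section StableSubspaces.
Variables (R : realType) (n : nat).
Variables (G : set 'M[R]_n) (g : {vspace 'M[R]_n}).
Hypothesis G_closed_subgroup : closed_subgroup_SL G.
Hypothesis G_connected : connected G.
Hypothesis g_lie : is_lie_algebra_of G g.

(** The stabilizer H of [P] is closed in [G]; by [subgroup_near_identity] it
    contains a neighbourhood of 1, and, being a subgroup, it is also open. *)
Lemma connected_group_stable (P : {vspace 'cV[R[i]]_n}) :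
  (forall X v, X \in g -> v \in P -> complexify_mx X *m v \in P) ->
  forall A v, G A -> v \in P -> complexify_mx A *m v \in P.
Proof.
move=> gP.
pose st (A : 'M[R]_n) := forall v, v \in P -> complexify_mx A *m v \in P.
pose H := [set A | G A /\ st A].
have [_ G1 GM GV Gc] := G_closed_subgroup.
have st_open A : ~ st A -> exists2 d, 0 < d & forall B, mxnorm1 (B - A) < d -> ~ st B.
  move=> nst; have [v vP Av] : exists2 v, v \in P & complexify_mx A *m v \notin P.
    apply: contrapT => nv; apply: nst => v vP; apply/negPn/negP => Av.
    by apply: nv; exists v.
  have [T [TA T0]] := separate_complex_subspace Av.
  have [c c0 Tc] := functional_bound T.
  exists (`|T A| / c) => [|B lt stB]; first by rewrite divr_gt0 ?normr_gt0.
  have := Tc (B - A); rewrite linearB /= T0 ?stB // sub0r normrN leNgt => /negP; apply.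
  by rewrite mulrC -ltr_pdivlMr.
have st1 : st 1%:M by move=> v; rewrite /complexify_mx map_mx1 mul1mx.
have stM A B : st A -> st B -> st (A *m B).
  by move=> sA sB v /sB/sA; rewrite mulmxA -complexify_mxM.
have stV A : A \in unitmx -> st A -> st (invmx A).
  move=> uA sA v vP.
  have uA' : complexify_mx A \in unitmx by rewrite /complexify_mx map_unitmx.
  pose f := linfun (mulmx (complexify_mx A) : 'cV[R[i]]_n -> 'cV[R[i]]_n).
  have fP : (f @: P)%VS = P.
    apply/eqP; rewrite eqEdim; apply/andP; split.
      by apply/subvP => _ /memv_imgP[u uP ->]; rewrite lfunE /= sA.
    rewrite limg_dim_eq //; apply/eqP; rewrite -subv0; apply/subvP => u.
    rewrite memv_cap memv_ker lfunE /= => /andP[_ /eqP Au]; rewrite memv0.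
    by rewrite -[u](mulKmx uA') Au mulmx0.
  have := vP; rewrite -{1}fP => /memv_imgP[u uP ->]; rewrite lfunE /=.
  by rewrite mulmxA -complexify_mxM mulVmx // /complexify_mx map_mx1 mul1mx.
have HH : H = G.
  have [d d0 dP] : exists2 d, 0 < d & forall A, G A -> mxnorm1 (A - 1%:M) < d -> H A.
    apply: (@subgroup_near_identity _ _ G H g G_closed_subgroup g_lie).
    - by move=> A [].
    - by split; [exact: G1 | exact: st1].
    - by move=> A B [GA sA] [GB sB]; split; [apply: GM | apply: stM].
    - move=> A [GA sA]; split; first exact: GV.
      exact: stV (closed_subgroup_unit G_closed_subgroup GA) sA.
    - move=> A GA nHA; have [|e e0 eP] := st_open A.
        by move=> sA; apply: nHA.
      by exists e => [|B /eP nsB]; [exact: e0 | case].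
    - move=> X Xg; rewrite -[X]scale1r; split; first by have /g_lie := Xg.
      by apply: expmx_stable => v; apply: gP.
  apply: G_connected.
  - by exists 1%:M.
  - exists [set B | exists2 A, H A & mxnorm1 (invmx A *m B - 1%:M) < d].
      apply/open_mxnorm1P => B [A HA lt].
      pose c := 1 + mxnorm1 (invmx A).
      have c0 : 0 < c by rewrite ltr_wpDr ?mxnorm1_ge0.
      exists ((d - mxnorm1 (invmx A *m B - 1%:M)) / c); first by rewrite divr_gt0 // subr_gt0.
      move=> B'; rewrite ltr_pdivlMr // => lt'; exists A => //.
      have -> : invmx A *m B' - 1%:M = invmx A *m (B' - B) + (invmx A *m B - 1%:M).
        by rewrite mulmxBr addrA subrK.
      apply: le_lt_trans (ler_mxnorm1D _ _) _; rewrite -ltrBrDr.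
      apply: le_lt_trans lt'; apply: le_trans (ler_mxnorm1M _ _) _.
      by rewrite mulrC ler_wpM2l ?mxnorm1_ge0 // /c lerDr.
    apply/seteqP; split=> B.
      move=> HB; have [GB _] := HB; split=> //; exists B => //.
      by rewrite mulVmx ?(closed_subgroup_unit G_closed_subgroup) // subrr mxnorm1_0.
    move=> [GB [A HA lt]]; have [GA sA] := HA.
    have [_ sAB] := dP _ (GM _ _ (GV _ GA) GB) lt.
    split; first exact: GB.
    rewrite -[B](mulKVmx (closed_subgroup_unit G_closed_subgroup GA)).
    exact: stM sA sAB.
  - exists st => //; rewrite -[st]setCK; apply: open_closedC.
    apply/open_mxnorm1P => A /st_open[e e0 eP].
    by exists e.
move=> A v; rewrite -HH => -[_ sA]; exact: sA.
Qed.

End StableSubspaces.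

(** * Complexification and conjugation *)
Section Complexification.
Variable R : realType.
Implicit Types (m p n : nat).

Definition conj_mx m p (A : 'M[R[i]]_(m, p)) : 'M[R[i]]_(m, p) :=
  map_mx Num.conj A.

Local Notation "A ^cj" := (conj_mx A) (at level 1, format "A ^cj").

Lemma conj_mxK m p (A : 'M[R[i]]_(m, p)) : (A^cj)^cj = A.
Proof. by apply/matrixP => i j; rewrite !mxE conjCK. Qed.

Lemma conj_mxD m p (A B : 'M[R[i]]_(m, p)) : (A + B)^cj = A^cj + B^cj.
Proof. by apply/matrixP => i j; rewrite !mxE rmorphD. Qed.

Lemma conj_mxZ m p c (A : 'M[R[i]]_(m, p)) : (c *: A)^cj = c^* *: A^cj.
Proof. by apply/matrixP => i j; rewrite !mxE rmorphM. Qed.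

Lemma conj_mx0 m p : (0 : 'M[R[i]]_(m, p))^cj = 0.
Proof. by apply/matrixP => i j; rewrite !mxE conjC0. Qed.

Lemma conj_mxM m p q (A : 'M[R[i]]_(m, p)) (B : 'M[R[i]]_(p, q)) :
  (A *m B)^cj = A^cj *m B^cj.
Proof. exact: map_mxM. Qed.

Lemma conj_complexify m p (A : 'M[R]_(m, p)) : (complexify_mx A)^cj = complexify_mx A.
Proof. by apply/matrixP => i j; rewrite !mxE; congr Complex; rewrite oppr0. Qed.

Lemma complexify_mx_re_im m p (A : 'M[R[i]]_(m, p)) :
  A = complexify_mx (map_mx (@complex.Re R) A) +
      Complex 0 1 *: complexify_mx (map_mx (@complex.Im R) A).
Proof. by apply/matrixP => i j; rewrite !mxE; apply: complexE. Qed.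

Lemma complexify_mx_inj m p : injective (@complexify_mx R m p).
Proof.
by move=> A B e; apply/matrixP => i j; have /matrixP/(_ i j) := e; rewrite !mxE => -[].
Qed.

Lemma complexify_mx0 m p : complexify_mx (0 : 'M[R]_(m, p)) = 0.
Proof. exact: map_mx0. Qed.

Lemma mem_complexify_real m p (W : {vspace 'M[R]_(m, p)}) A :
  A \in W -> complexify_mx A \in complexify W.
Proof.
move=> AW; apply/mem_complexify; exists A, 0; split=> //; first exact: mem0v.
by rewrite complexify_mx0 scaler0 addr0.
Qed.

Lemma complexify_stable n (q : {vspace 'M[R]_n}) (L : {vspace 'cV[R[i]]_n}) :
  (forall X v, X \in q -> v \in L -> complexify_mx X *m v \in L) ->
  forall X v, X \in complexify q -> v \in L -> X *m v \in L.
Proof.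
move=> qL _ v /mem_complexify[x [y [xq yq ->]]] vL.
by rewrite mulmxDl -scalemxAl memvD ?memvZ ?qL.
Qed.

Lemma complexify_lie_bracket n (g : {vspace 'M[R]_n}) :
  (lie_bracketv g g <= g)%VS ->
  (lie_bracketv (complexify g) (complexify g) <= complexify g)%VS.
Proof.
move=> /lie_bracketv_subP gg; apply/lie_bracketv_subP.
have cbr (A B : 'M[R]_n) :
    lie_bracket (complexify_mx A) (complexify_mx B) = complexify_mx (lie_bracket A B).
  by rewrite /lie_bracket -!complexify_mxM /complexify_mx map_mxB.
have cg (A B : 'M[R]_n) : A \in g -> B \in g ->
    lie_bracket (complexify_mx A) (complexify_mx B) \in complexify g.
  by move=> Ag Bg; rewrite cbr mem_complexify_real // gg.
move=> _ _ /mem_complexify[x [y [xg yg ->]]] /mem_complexify[x' [y' [xg' yg' ->]]].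
rewrite linearD linearZ /= !lie_bracketDl !lie_bracketZl.
by do ![apply: cg | apply: memvZ | apply: memvD].
Qed.

Lemma adjmx_complexify m p (A : 'M[R]_(m, p)) : adjmx (complexify_mx A) = complexify_mx A^T.
Proof. by rewrite /adjmx -/(conj_mx _) conj_complexify /complexify_mx map_trmx. Qed.

Lemma complexify_adj n (g : {vspace 'M[R]_n}) :
  (forall X, X \in g -> X^T \in g) ->
  forall X, X \in complexify g -> adjmx X \in complexify g.
Proof.
move=> gT _ /mem_complexify[x [y [xg yg ->]]].
rewrite adjmxD adjmxZ !adjmx_complexify memvD ?memvZ // mem_complexify_real //; exact: gT.
Qed.

Lemma exists_conj_space n (L : {vspace 'cV[R[i]]_n}) :
  exists M : {vspace 'cV[R[i]]_n}, forall v, (v \in M) = (v^cj \in L).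
Proof.
pose M := <<[seq v^cj | v <- vbasis L]>>%VS.
have sub v : v \in L -> v^cj \in M.
  move=> vL; rewrite (coord_vbasis vL).
  apply: (big_ind (fun v => v^cj \in M)) => [|A B eA eB|i _].
  - by rewrite conj_mx0 mem0v.
  - by rewrite conj_mxD memvD.
  - by rewrite conj_mxZ memvZ // memv_span // map_f // mem_nth // size_tuple.
exists M => v; apply/idP/idP => [/coord_span ->|/sub]; last by rewrite conj_mxK.
apply: (big_ind (fun v => v^cj \in L)) => [|A B eA eB|i _].
- by rewrite conj_mx0 mem0v.
- by rewrite conj_mxD memvD.
- rewrite conj_mxZ memvZ //.
  have : (in_tuple [seq v^cj | v <- vbasis L])`_i \in [seq v^cj | v <- vbasis L].
    by apply: mem_nth; rewrite size_map size_tuple.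
  by case/mapP => u /vbasis_mem uL ->; rewrite conj_mxK.
Qed.

Lemma exists_real_points n (L : {vspace 'cV[R[i]]_n}) :
  exists W : {vspace 'cV[R]_n}, forall x, (x \in W) = (complexify_mx x \in L).
Proof.
pose r (x : 'cV[R]_n) : 'cV[R[i]]_n := complexify_mx x - projv L (complexify_mx x).
have rlin c A B : r (c *: A + B) = real_complex R c *: r A + r B.
  by rewrite /r complexify_mxDZ linearD linearZ /=; vector_ring.
pose f1 x := map_mx (@complex.Re R) (r x); pose f2 x := map_mx (@complex.Im R) (r x).
have l1 : linear f1.
  move=> c A B; rewrite /f1 rlin; move: (r A) (r B) => u w.
  by apply/matrixP => i j; rewrite !mxE Re_realD.
have l2 : linear f2.
  move=> c A B; rewrite /f2 rlin; move: (r A) (r B) => u w.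
  by apply/matrixP => i j; rewrite !mxE Im_realD.
pose m1 := GRing.isLinear.Build R _ _ _ f1 l1.
pose m2 := GRing.isLinear.Build R _ _ _ f2 l2.
pose F1 : {linear 'cV[R]_n -> 'cV[R]_n} := HB.pack f1 m1.
pose F2 : {linear 'cV[R]_n -> 'cV[R]_n} := HB.pack f2 m2.
exists (lker (linfun F1) :&: lker (linfun F2))%VS => x.
rewrite memv_cap !memv_ker !lfunE /= /f1 /f2.
apply/andP/idP => [[/eqP e1 /eqP e2]|xL].
  have : r x = 0.
    by rewrite [r x]complexify_mx_re_im e1 e2 !complexify_mx0 scaler0 addr0.
  by move/eqP; rewrite subr_eq0 => /eqP ->; apply: memv_proj.
have -> : r x = 0 by rewrite /r projv_id // subrr.
by split; apply/eqP/matrixP => i j; rewrite !mxE.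
Qed.

(** The real and imaginary parts of [v] are combinations of [v] and its
    conjugate. *)
Lemma conj_stable_complexify n (L : {vspace 'cV[R[i]]_n}) (W : {vspace 'cV[R]_n}) :
  (forall x, (x \in W) = (complexify_mx x \in L)) ->
  (forall v, v \in L -> v^cj \in L) -> L = complexify W.
Proof.
move=> WL cL; apply/vspaceP => v; apply/idP/idP => [vL|]; last first.
  by move=> /mem_complexify[x [y [+ + ->]]]; rewrite !WL => xL yL; rewrite memvD ?memvZ.
set x := map_mx (@complex.Re R) v; set y := map_mx (@complex.Im R) v.
have ev : v = complexify_mx x + Complex 0 1 *: complexify_mx y := complexify_mx_re_im v.
have ecv : v^cj = complexify_mx x - Complex 0 1 *: complexify_mx y.
  rewrite {1}ev conj_mxD conj_mxZ !conj_complexify -scaleNr.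
  by congr (_ + _ *: _); congr Complex; rewrite ?oppr0.
have xL : complexify_mx x \in L.
  have e : complexify_mx x = 2^-1 *: (v + v^cj).
    rewrite ecv {1}ev; apply: eq_on_scalars => phi.
    by rewrite !(linearD phi, linearN phi, scalarZ phi) /=; field.
  by rewrite e memvZ // memvD ?cL.
have yL : complexify_mx y \in L.
  have i0 : (Complex 0 1 : R[i]) != 0 by rewrite eq_complex /= oner_eq0 andbF.
  have e : Complex 0 1 *: complexify_mx y = v - complexify_mx x by rewrite {1}ev addrC addKr.
  by rewrite -[complexify_mx y](scalerK i0) e memvZ // memvB.
by apply/mem_complexify; exists x, y; rewrite !WL.
Qed.

End Complexification.

(** * Irreducible subspaces of parabolic subgroups *)
Theorem corollary49 (R : realType) (n : nat)
    (G : set 'M[R]_n) (g : {vspace 'M[R]_n})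
    (G_closed_subgroup : closed_subgroup_SL G)
    (G_connected : connected G)
    (G_noncompact : ~ compact G)
    (g_lie : is_lie_algebra_of G g)
    (g_semisimple : lie_semisimple g)
    (G_compatible : compatible_decomposition G g)
    (G_irr_real : irreducible_action G (fullv : {vspace 'cV[R]_n}))
    (G_irr_complex :
       irreducible_action (complexify_set G) (fullv : {vspace 'cV[R[i]]_n}))
    (Q : set 'M[R]_n) (Q_parabolic : parabolic_subgroup G g Q)
    (L : {vspace 'cV[R[i]]_n})
    (L_invariant : invariant_subspace (complexify_set Q) L)
    (L_irreducible : irreducible_action (complexify_set Q) L) :
  exists W : {vspace 'cV[R]_n},
    [/\ invariant_subspace Q W, irreducible_action Q W & L = complexify W].
Proof.
have g_br := lie_algebra_bracket G_closed_subgroup g_lie.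
have g_tr := lie_algebra_tr G_closed_subgroup g_lie G_compatible.
pose gC := complexify g.
have gC_br : (lie_bracketv gC gC <= gC)%VS := complexify_lie_bracket g_br.
have gC_adj : forall X, X \in gC -> adjmx X \in gC := complexify_adj g_tr.
have gC_irr (P : {vspace 'cV[R[i]]_n}) :
    (forall X v, X \in gC -> v \in P -> X *m v \in P) -> P = 0%VS \/ P = fullv.
  move=> gP; case: G_irr_complex => _ _ irr; apply: irr; first exact: subvf.
  move=> _ [A GA <-] v vP; apply: connected_group_stable GA vP => //.
  by move=> X u Xg; apply: gP; apply: mem_complexify_real.
have [q [q_sub [qC_sub [b b_borel bq]]] eQ] := Q_parabolic.
(* The one-parameter groups generated by q lie in Q. *)
have qL X v : X \in q -> v \in L -> complexify_mx X *m v \in L.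
  move=> Xq; move: v; apply: expmx_stable_generator => t v vL.
  apply: L_invariant vL; exists (expmx (t *: X)) => //; rewrite eQ.
  exact: expmx_normalizes.
have [M ML] := exists_conj_space L.
have qM X v : X \in q -> v \in M -> complexify_mx X *m v \in M.
  by move=> Xq; rewrite !ML => /(qL X _ Xq); rewrite conj_mxM conj_complexify.
have [L0 _ irrL] := L_irreducible.
have M0 : M != 0%VS.
  apply: contraNneq L0 => M0; rewrite -subv0; apply/subvP => v vL.
  have : conj_mx v \in M by rewrite ML conj_mxK.
  by rewrite M0 !memv0 => /eqP e; rewrite -[v]conj_mxK e conj_mx0.
have [[bg b_br] b_sol _] := b_borel.
have bS (P : {vspace 'cV[R[i]]_n}) :
    (forall X v, X \in q -> v \in P -> complexify_mx X *m v \in P) ->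
    forall X v, X \in b -> v \in P -> X *m v \in P.
  by move=> qP X v Xb; apply: (complexify_stable qP); apply: (subvP bq).
have [v [vL v0 bv]] := lie_theorem b_sol b_br L0 (bS L qL).
have [w [wM w0 bw]] := lie_theorem b_sol b_br M0 (bS M qM).
have /vlineP[c wc] := borel_eigenvector_unique gC_br gC_adj b_borel gC_irr v0 w0 bv bw.
(* w is a nonzero vector of L and of its conjugate M. *)
have LM : (L :&: M)%VS = L.
  have [||LM0|//] := irrL (L :&: M)%VS; first exact: capvSl.
    move=> _ [A QA <-] u; rewrite !memv_cap !ML => /andP[uL cuL].
    have QcA : complexify_set Q (complexify_mx A) by exists A.
    by rewrite conj_mxM conj_complexify !L_invariant.
  have : w \in (L :&: M)%VS by rewrite memv_cap wM wc memvZ.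
  by rewrite LM0 memv0 (negbTE w0).
have cL u : u \in L -> conj_mx u \in L.
  by rewrite -{1}LM memv_cap ML => /andP[].
have [W WL] := exists_real_points L.
have LW : L = complexify W := conj_stable_complexify WL cL.
have W_inv : invariant_subspace Q W.
  move=> A QA x; rewrite !WL complexify_mxM; apply: L_invariant.
  by exists A.
exists W; split=> //; split=> //.
  apply: contraNneq L0 => W0; rewrite LW W0 -subv0; apply/subvP => u.
  move=> /mem_complexify[x [y [+ + ->]]]; rewrite !memv0 => /eqP-> /eqP->.
  by rewrite complexify_mx0 scaler0 addr0.
move=> U UW U_inv.
have cUL : (complexify U <= L)%VS.
  apply/subvP => u /mem_complexify[x [y [/(subvP UW) + /(subvP UW) + ->]]].
  by rewrite !WL => xL yL; rewrite memvD ?memvZ.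
have [|cU0|cUf] := irrL _ cUL.
- move=> _ [A QA <-] u /mem_complexify[x [y [xU yU ->]]].
  apply/mem_complexify; exists (A *m x), (A *m y); split; try exact: U_inv.
  by rewrite mulmxDr -scalemxAr !complexify_mxM.
- left; apply/eqP; rewrite -subv0; apply/subvP => x /mem_complexify_real.
  by rewrite cU0 !memv0 -(complexify_mx0 R n 1) => /eqP/complexify_mx_inj->.
right; apply/eqP; rewrite eqEsubv UW; apply/subvP => x.
rewrite WL -cUf => /mem_complexify[a [b' [aU _ e]]].
suff -> : x = a by [].
apply/matrixP => i j; have /matrixP/(_ i j) := e; rewrite !mxE => /(congr1 (@complex.Re R)).
by rewrite /= mul0r mul1r oppr0 !addr0.
Qed.
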